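(* Let $\Lambda$ be an artin algebra, let $M$ be a left $\Lambda$-module, let $n$ be a positive integer and let $D$ be the standard duality. Then $M$ is an $n$-factor serial left $\Lambda$-module if and only if $D(M)$ is an $n$-cofactor serial right $\Lambda$-module.
   Context: An artin algebra is an algebra $\Lambda$ over a commutative artinian ring $R$ that is finitely generated as an $R$-module. All modules are finitely generated. Standard duality: let $\{S_1,\dots,S_r\}$ be a complete set of representatives of isomorphism classes of simple $R$-modules, $J=\bigoplus_{i=1}^r I(S_i)$ with $I(S_i)$ the injective envelope of $S_i$; $D=\mathrm{Hom}_R(-,J)$ is a duality between finitely generated right and finitely generated left $\Lambda$-modules (in either direction). For a module $M$: $\mathrm{rad}^0(M)=M$, $\mathrm{rad}^{i+1}(M)=\mathrm{rad}(\mathrm{rad}^i(M))$; and $\mathrm{soc}^0(M)=0$, with $\mathrm{soc}^{i+1}(M)$ the submodule containing $\mathrm{soc}^i(M)$ such that $\mathrm{soc}^{i+1}(M)/\mathrm{soc}^i(M)=\mathrm{soc}(M/\mathrm{soc}^i(M))$. A module is uniserial if it has a unique composition series (the zero module counts as uniserial). Let $M$ be a nonzero module of length $l$. $M$ is $1$-factor serial, equivalently $1$-cofactor serial, if it is uniserial. For $l\ge n>1$: $M$ is $n$-factor serial if $M/\mathrm{rad}^{l-n}(M)$ is uniserial and $M/\mathrm{rad}^{l-n+1}(M)$ is not uniserial; $M$ is $n$-cofactor serial if $\mathrm{soc}^{l-n}(M)$ is uniserial and $\mathrm{soc}^{l-n+1}(M)$ is not uniserial. *)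

(* Defs.v *)
From HB Require Import structures.
From mathcomp Require Import all_boot all_algebra.
From mathcomp Require Import boolp.

Set Implicit Arguments.
Unset Strict Implicit.
Unset Printing Implicit Defensive.

Import GRing.Theory.
Local Open Scope ring_scope.
Local Open Scope quotient_scope.

(* Left modules over a ring A are the [lmodType A]; right A-modules are the    *)
(* [lmodType A^c], where A^c is the converse (opposite) ring. Submodules are   *)
(* MathComp's [submodClosed V]. They are boolean predicates, which classically *)
(* is no restriction, and are compared extensionally with [=i].                *)

(** * Submodules and quotients *)

Section SubmoduleConstructions.
Context (A : pzRingType) (V : lmodType A).

Definition submod_prop (P : V -> Prop) : Prop :=
  [/\ P 0, forall x y, P x -> P y -> P (x + y) & forall a x, P x -> P (a *: x)].

Section PropSubmodule.
Context (P : V -> Prop) (modP : submod_prop P).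

Definition asbool_pred of submod_prop P : {pred V} := fun x => `[< P x >].

Fact asbool_pred_closed : GRing.subsemimod_closed (asbool_pred modP).
Proof.
case: (modP) => P0 PD PZ; split; last first.
  by move=> a x /asboolP Px; apply/asboolP/PZ.
split; first exact/asboolP.
by move=> x y /asboolP Px /asboolP Py; apply/asboolP/PD.
Qed.

HB.instance Definition _ :=
  GRing.isSubSemiModClosed.Build A V (asbool_pred modP) asbool_pred_closed.

Definition submod_of : submodClosed V := asbool_pred modP.

Lemma submod_ofE x : (x \in submod_of) <-> P x.
Proof. by split=> /asboolP. Qed.
End PropSubmodule.

Fact zero_submod_prop : submod_prop (fun x => x = 0).
Proof. by split=> [//|x y -> ->|a x ->]; rewrite ?addr0 ?scaler0. Qed.

Definition zero_submod : submodClosed V := submod_of zero_submod_prop.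

Fact full_submod_prop : submod_prop (fun=> True). Proof. by []. Qed.

Definition full_submod : submodClosed V := submod_of full_submod_prop.

Section SubType.
Context (N : submodClosed V).

Definition submod : Type := {x : V | x \in N}.
HB.instance Definition _ := SubChoice.on submod.
HB.instance Definition _ := [SubChoice_isSubLmodule of submod by <:].
End SubType.

Section QuotientType.
Context (N : submodClosed V).

Definition quot_equiv (x y : V) : bool := x - y \in N.

Fact submod_opp x : x \in N -> - x \in N.
Proof. by move=> Nx; rewrite -scaleN1r rpredZ. Qed.

Fact quot_equiv_is_equiv : equiv_class_of quot_equiv.
Proof.
split=> [x|x y|y x z]; rewrite /quot_equiv ?subrr ?rpred0 //.
  by apply/idP/idP => /submod_opp; rewrite opprB.
by move=> Nxy Nyz; rewrite -[x](addrNK y) -addrA rpredD.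
Qed.

Canonical quot_equiv_equiv := EquivRelPack quot_equiv_is_equiv.
Canonical quot_equiv_encModRel := defaultEncModRel quot_equiv.

Definition quotmod : Type := {eq_quot quot_equiv}.
HB.instance Definition _ : EqQuotient V quot_equiv quotmod :=
  EqQuotient.on quotmod.
HB.instance Definition _ := Choice.on quotmod.

Let eqm x y : (x == y %[mod quotmod]) = (x - y \in N).
Proof. by rewrite piE. Qed.

Definition quot_zero : quotmod := lift_cst quotmod 0.
Definition quot_add := lift_op2 quotmod +%R.
Definition quot_opp := lift_op1 quotmod -%R.
Definition quot_scale (a : A) := lift_op1 quotmod ( *:%R a).

Canonical pi_quot_zero_morph := PiConst quot_zero.

Fact pi_quot_opp : {morph \pi : x / - x >-> quot_opp x}.
Proof.
move=> x; unlock quot_opp; apply/eqP; rewrite eqm -opprD.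
by rewrite submod_opp // -eqm reprK.
Qed.
Canonical pi_quot_opp_morph := PiMorph1 pi_quot_opp.

Fact pi_quot_add : {morph \pi : x y / x + y >-> quot_add x y}.
Proof.
move=> x y /=; unlock quot_add; apply/eqP; rewrite eqm.
by rewrite opprD addrACA rpredD // -eqm reprK.
Qed.
Canonical pi_quot_add_morph := PiMorph2 pi_quot_add.

Fact pi_quot_scale a : {morph \pi : x / a *: x >-> quot_scale a x}.
Proof.
move=> x; unlock quot_scale; apply/eqP.
by rewrite eqm -scalerBr rpredZ // -eqm reprK.
Qed.
Canonical pi_quot_scale_morph a := PiMorph1 (pi_quot_scale a).

Fact quot_addA : associative quot_add.
Proof. by move=> x y z; rewrite -[x]reprK -[y]reprK -[z]reprK !piE addrA. Qed.

Fact quot_addC : commutative quot_add.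
Proof. by move=> x y; rewrite -[x]reprK -[y]reprK !piE addrC. Qed.

Fact quot_add0 : left_id quot_zero quot_add.
Proof. by move=> x; rewrite -[x]reprK !piE add0r. Qed.

Fact quot_addN : left_inverse quot_zero quot_opp quot_add.
Proof. by move=> x; rewrite -[x]reprK !piE addNr. Qed.

HB.instance Definition _ :=
  GRing.isZmodule.Build quotmod quot_addA quot_addC quot_add0 quot_addN.

Fact quot_scaleA a b x :
  quot_scale a (quot_scale b x) = quot_scale (a * b) x.
Proof. by rewrite -[x]reprK !piE scalerA. Qed.

Fact quot_scale1 : left_id 1 quot_scale.
Proof. by move=> x; rewrite -[x]reprK !piE scale1r. Qed.

Fact quot_scaleDr : right_distributive quot_scale +%R.
Proof.
by move=> a x y; rewrite -[x]reprK -[y]reprK /GRing.add /= !piE scalerDr.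
Qed.

Fact quot_scaleDl x : {morph quot_scale^~ x : a b / a + b}.
Proof. by move=> a b; rewrite -[x]reprK /GRing.add /= !piE scalerDl. Qed.

HB.instance Definition _ := GRing.Zmodule_isLmodule.Build A quotmod
  quot_scaleA quot_scale1 quot_scaleDr quot_scaleDl.

Definition quot_proj (x : V) : quotmod := \pi_quotmod x.

Fact quot_proj_is_linear : linear quot_proj.
Proof.
by move=> a x y; rewrite /quot_proj /GRing.add /GRing.scale /= !piE.
Qed.

HB.instance Definition _ :=
  GRing.isLinear.Build A V quotmod _ quot_proj quot_proj_is_linear.
End QuotientType.
End SubmoduleConstructions.

(** * Composition series, radical and socle series *)

Section ModuleNotions.
Context (A : pzRingType).
Implicit Type V : lmodType A.

Definition nonzero_module V : Prop := exists x : V, x != 0.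

Definition simple_module V : Prop :=
  nonzero_module V /\
  forall N : submodClosed V, N =i zero_submod V \/ N =i full_submod V.

Definition fin_gen V : Prop :=
  exists (k : nat) (v : 'I_k -> V),
    forall x, exists c : 'I_k -> A, x = \sum_i c i *: v i.

(* K is a maximal submodule of N, i.e. K is contained in N with simple factor *)
Definition maximal_in V (K N : submodClosed V) : Prop :=
  [/\ {subset K <= N}, ~ (K =i N) &
      forall L : submodClosed V, {subset K <= L} -> {subset L <= N} ->
        L =i K \/ L =i N].

(* 0 = C 0 < C 1 < ... < C l = V; the values C i with i > l are irrelevant *)
Definition composition_series V (l : nat) (C : nat -> submodClosed V) : Prop :=
  [/\ C 0 =i zero_submod V, C l =i full_submod V &
      forall i, (i < l)%N -> maximal_in (C i) (C i.+1)].

Definition has_length V (l : nat) : Prop :=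
  exists C : nat -> submodClosed V, composition_series l C.

Definition uniserial V : Prop :=
  (exists l (C : nat -> submodClosed V), composition_series l C) /\
  forall l (C : nat -> submodClosed V) l' (C' : nat -> submodClosed V),
    composition_series l C -> composition_series l' C' ->
    l = l' /\ forall i, (i <= l)%N -> C i =i C' i.

Fact rad_prop V : submod_prop (fun x : V =>
  forall K : submodClosed V, maximal_in K (full_submod V) -> x \in K).
Proof.
split=> [K _|x y radx rady K maxK|a x radx K maxK]; first exact: rpred0.
  by rewrite rpredD ?radx ?rady.
by rewrite rpredZ ?radx.
Qed.

(* The whole module if there is no maximal submodule *)
Definition rad V : submodClosed V := submod_of (@rad_prop V).

Fact soc_prop V : submod_prop (fun x : V =>
  exists2 s : seq V,
    (forall y, y \in s ->
       exists2 N : submodClosed V, simple_module (submod N) & y \in N)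
    & x = \sum_(y <- s) y).
Proof.
split=> [|x y [s ss ->] [t st ->]|a x [s ss ->]].
- by exists [::]; rewrite ?big_nil.
- exists (s ++ t); last by rewrite big_cat.
  by move=> z; rewrite mem_cat => /orP[/ss|/st].
- exists [seq a *: y | y <- s]; last by rewrite big_map scaler_sumr.
  move=> _ /mapP[y /ss[N simN Ny] ->]; exists N => //.
  by rewrite rpredZ.
Qed.

(* The sum of the simple submodules *)
Definition soc V : submodClosed V := submod_of (@soc_prop V).

Fact submod_image_prop V (N : submodClosed V) (K : submodClosed (submod N)) :
  submod_prop (fun x : V => exists2 y : submod N, y \in K & x = \val y).
Proof.
split=> [|x x' [y Ky ->] [y' Ky' ->]|a x [y Ky ->]].
- by exists 0; rewrite ?rpred0 // raddf0.
- by exists (y + y'); rewrite ?rpredD // raddfD.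
- by exists (a *: y); rewrite ?rpredZ.
Qed.

Definition submod_image V (N : submodClosed V) (K : submodClosed (submod N)) :
  submodClosed V := submod_of (submod_image_prop K).

Fact quot_preim_prop V (N : submodClosed V) (K : submodClosed (quotmod N)) :
  submod_prop (fun x : V => quot_proj N x \in K).
Proof.
split=> [|x y Kx Ky|a x Kx]; first by rewrite raddf0 rpred0.
  by rewrite raddfD rpredD.
by rewrite linearZ rpredZ.
Qed.

Definition quot_preim V (N : submodClosed V) (K : submodClosed (quotmod N)) :
  submodClosed V := submod_of (quot_preim_prop K).

Fixpoint rad_iter V (i : nat) : submodClosed V :=
  if i is j.+1 then submod_image (rad (submod (rad_iter V j)))
  else full_submod V.

Fixpoint soc_iter V (i : nat) : submodClosed V :=
  if i is j.+1 then quot_preim (soc (quotmod (soc_iter V j)))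
  else zero_submod V.

Definition n_factor_serial (n : nat) V : Prop :=
  nonzero_module V /\
  if n == 1 then uniserial V else
  exists l, [/\ has_length V l, (1 < n <= l)%N,
    uniserial (quotmod (rad_iter V (l - n))) &
    ~ uniserial (quotmod (rad_iter V (l - n + 1)))].

Definition n_cofactor_serial (n : nat) V : Prop :=
  nonzero_module V /\
  if n == 1 then uniserial V else
  exists l, [/\ has_length V l, (1 < n <= l)%N,
    uniserial (submod (soc_iter V (l - n))) &
    ~ uniserial (submod (soc_iter V (l - n + 1)))].

Definition isomorphic_modules (U V : lmodType A) : Prop :=
  exists f : {linear U -> V}, bijective f.

Definition injective_module (E : lmodType A) : Prop :=
  forall (U V : lmodType A) (i : {linear U -> V}) (f : {linear U -> E}),
    injective i -> exists g : {linear V -> E}, forall x, g (i x) = f x.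

(* E is an injective envelope of S: injective, with an essential embedding of S *)
Definition injective_envelope (S E : lmodType A) : Prop :=
  injective_module E /\
  exists2 f : {linear S -> E}, injective f &
    forall N : submodClosed E,
      (forall x, f x \in N -> f x = 0) -> N =i zero_submod E.

Definition complete_simples (r : nat) (S : 'I_r -> lmodType A) : Prop :=
  [/\ forall i, simple_module (S i),
      forall i j, isomorphic_modules (S i) (S j) -> i = j &
      forall T : lmodType A, simple_module T ->
        exists i, isomorphic_modules T (S i)].

(* Descending chain condition on the left ideals, i.e. submodules of A itself *)
Definition artinian : Prop :=
  forall I : nat -> submodClosed A^o,
    (forall k, {subset I k.+1 <= I k}) ->
    exists k, forall m, (k <= m)%N -> I m =i I k.
End ModuleNotions.

Arguments artinian A : clear implicits.

Definition artin_algebra (R : comPzRingType) (L : algType R) : Prop :=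
  artinian R /\ fin_gen (L : lmodType R).

(** * Finite direct sums *)

Section DirectSum.
Context (R : pzRingType) (r : nat) (E : 'I_r -> lmodType R).

Definition dirsum : Type := {dffun forall i, E i}.
HB.instance Definition _ := Choice.on dirsum.
Implicit Types f g h : dirsum.

Definition dirsum_zero : dirsum := [ffun i => 0 : E i].
Definition dirsum_opp f : dirsum := [ffun i => - f i].
Definition dirsum_add f g : dirsum := [ffun i => f i + g i].
Definition dirsum_scale (a : R) f : dirsum := [ffun i => a *: f i].

Fact dirsum_addA : associative dirsum_add.
Proof. by move=> f g h; apply/ffunP=> i; rewrite !ffunE addrA. Qed.

Fact dirsum_addC : commutative dirsum_add.
Proof. by move=> f g; apply/ffunP=> i; rewrite !ffunE addrC. Qed.

Fact dirsum_add0 : left_id dirsum_zero dirsum_add.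
Proof. by move=> f; apply/ffunP=> i; rewrite !ffunE add0r. Qed.

Fact dirsum_addN : left_inverse dirsum_zero dirsum_opp dirsum_add.
Proof. by move=> f; apply/ffunP=> i; rewrite !ffunE addNr. Qed.

HB.instance Definition _ :=
  GRing.isZmodule.Build dirsum dirsum_addA dirsum_addC dirsum_add0 dirsum_addN.

Fact dirsum_scaleA a b f :
  dirsum_scale a (dirsum_scale b f) = dirsum_scale (a * b) f.
Proof. by apply/ffunP=> i; rewrite !ffunE scalerA. Qed.

Fact dirsum_scale1 : left_id 1 dirsum_scale.
Proof. by move=> f; apply/ffunP=> i; rewrite !ffunE scale1r. Qed.

Fact dirsum_scaleDr : right_distributive dirsum_scale +%R.
Proof. by move=> a f g; apply/ffunP=> i; rewrite !ffunE scalerDr. Qed.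

Fact dirsum_scaleDl f : {morph dirsum_scale^~ f : a b / a + b}.
Proof. by move=> a b; apply/ffunP=> i; rewrite !ffunE scalerDl. Qed.

HB.instance Definition _ := GRing.Zmodule_isLmodule.Build R dirsum
  dirsum_scaleA dirsum_scale1 dirsum_scaleDr dirsum_scaleDl.
End DirectSum.

(** * The standard duality *)

Section Duality.
Context (R : comPzRingType) (L : algType R) (M : lmodType L).

(* M as an R-module, by restriction of scalars along R -> L, a |-> a%:A *)
Definition restr : Type := M.
HB.instance Definition _ := GRing.Zmodule.on restr.

Definition restr_scale (a : R) (x : restr) : restr := (a%:A : L) *: (x : M).

Fact restr_scaleA a b x :
  restr_scale a (restr_scale b x) = restr_scale (a * b) x.
Proof. by rewrite /restr_scale scalerA -scalerAl mul1r scalerA. Qed.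

Fact restr_scale1 : left_id 1 restr_scale.
Proof. by move=> x; rewrite /restr_scale !scale1r. Qed.

Fact restr_scaleDr : right_distributive restr_scale +%R.
Proof. by move=> a x y; rewrite /restr_scale scalerDr. Qed.

Fact restr_scaleDl x : {morph restr_scale^~ x : a b / a + b}.
Proof. by move=> a b; rewrite /restr_scale scalerDl scalerDl. Qed.

HB.instance Definition _ := GRing.Zmodule_isLmodule.Build R restr
  restr_scaleA restr_scale1 restr_scaleDr restr_scaleDl.

Context (J : lmodType R).

(* Hom_R(M, J) *)
Definition dual : Type := {linear restr -> J}.
HB.instance Definition _ := gen_eqMixin dual.
HB.instance Definition _ := gen_choiceMixin dual.
Implicit Types f g h : dual.

Fact dualP f g : (forall x, f x = g x) -> f = g.
Proof.
case: f g => f cf [g cg] /= /funext fg.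
case: _ / fg in cg *; congr GRing.Linear.Pack.
case: cf cg => [[fD] [fZ]] [[gD] [gZ]].
by rewrite (Prop_irrelevance fD gD) (Prop_irrelevance fZ gZ).
Qed.

Definition dual_zero : dual := \0 : {linear restr -> J}.
Definition dual_opp f : dual := \- f : {linear restr -> J}.
Definition dual_add f g : dual := f \+ g : {linear restr -> J}.

Fact dual_addA : associative dual_add.
Proof. by move=> f g h; apply: dualP => x /=; rewrite addrA. Qed.

Fact dual_addC : commutative dual_add.
Proof. by move=> f g; apply: dualP => x /=; rewrite addrC. Qed.

Fact dual_add0 : left_id dual_zero dual_add.
Proof. by move=> f; apply: dualP => x /=; rewrite add0r. Qed.

Fact dual_addN : left_inverse dual_zero dual_opp dual_add.
Proof. by move=> f; apply: dualP => x /=; rewrite addNr. Qed.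

HB.instance Definition _ :=
  GRing.isZmodule.Build dual dual_addA dual_addC dual_add0 dual_addN.

Definition dual_scale_fun (l : L^c) f (x : restr) : J :=
  f ((l : L) *: (x : M) : restr).

Fact dual_scale_is_linear l f : linear (dual_scale_fun l f).
Proof.
move=> a x y; rewrite /dual_scale_fun -linearP; congr (f _).
rewrite [LHS](scalerDr (l : L) (a *: x : M) (y : M)); congr (_ + _).
have -> : a *: x = (a%:A : L) *: (x : M) :> M by [].
have -> (z : restr) : a *: z = (a%:A : L) *: (z : M) :> M by [].
by rewrite !scalerA mulr_algl mulr_algr.
Qed.

HB.instance Definition _ l f := GRing.isLinear.Build R restr J _
  (dual_scale_fun l f) (dual_scale_is_linear l f).

(* The right action of L on Hom_R(M, J): (f * l)(x) = f(l x) *)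
Definition dual_scale (l : L^c) f : dual := dual_scale_fun l f.

Fact dual_scaleA l l' f :
  dual_scale l (dual_scale l' f) = dual_scale (l * l') f.
Proof.
by apply: dualP => x; rewrite /= /dual_scale_fun /= /dual_scale_fun scalerA.
Qed.

Fact dual_scale1 : left_id 1 dual_scale.
Proof. by move=> f; apply: dualP => x; rewrite /= /dual_scale_fun scale1r. Qed.

Fact dual_scaleDr : right_distributive dual_scale +%R.
Proof. by move=> l f g; apply: dualP. Qed.

Fact dual_scaleDl f : {morph dual_scale^~ f : l l' / l + l'}.
Proof.
by move=> l l'; apply: dualP => x; rewrite /= /dual_scale_fun scalerDl raddfD.
Qed.

HB.instance Definition _ := GRing.Zmodule_isLmodule.Build L^c dual
  dual_scaleA dual_scale1 dual_scaleDr dual_scaleDl.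
End Duality.

(* Main.v *)
From HB Require Import structures.
Require Import Defs.
From mathcomp Require Import all_boot all_algebra.
From mathcomp Require Import boolp classical_sets.

(* Let J be the sum of the injective envelopes E_i of the simple R-modules.    *)
(* Taking annihilators is an order-reversing bijection between the submodules  *)
(* of M and those of D(M) = Hom_R(M, J), and such a bijection exchanges the    *)
(* radical series of M with the socle series of D(M), composition series of    *)
(* M / rad^i M with those of soc^i D(M), and hence factor serial with cofactor *)
(* serial. That every submodule N of M is the common kernel of its             *)
(* annihilator says that J is a cogenerator. That every submodule K of D(M) is *)
(* the annihilator of its common kernel N is proved by induction on the length *)
(* of M / N over R, which is finite because a commutative artinian ring has    *)
(* finite length; the induction step uses that every simple R-module T has a   *)
(* simple dual Hom_R(T, J), the S_i being pairwise non-isomorphic.             *)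

Set Implicit Arguments.
Unset Strict Implicit.
Unset Printing Implicit Defensive.

Import GRing.Theory.
Local Open Scope ring_scope.

(** * Unique maximal chains in posets *)

(** Every notion in the statement is read off from a lattice of submodules. By [uniserial_quotmod]
    and [uniserial_submod], [V / N] and [N] are uniserial when the intervals from [N] to [V] and
    from [0] to [N] have a unique maximal chain. By [rad_iterS_ge] and [soc_iterS_le], each radical
    layer is the meet of what its predecessor covers, and each socle layer the join of what covers
    its predecessor. So an order-reversing bijection of lattices carries [rad_iter] to [soc_iter]
    and factor serial to cofactor serial ([anti_factor_serial]).

    It remains to see that [annihilator] and [common_kernel] are mutually inverse between the
    submodules of [M] and those of [dual M J], for [J] the sum of the injective envelopes. One
    composite is the identity because [J] separates points from submodules ([dirsum_cogenerator]).
    The other rests on [annihilator_closed], which needs two facts: [J] contains each simple module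
    at most once ([dirsum_multiplicity_free]), and [M] has finite length over [R]
    ([fin_gen_finite_length], resting on [artinian_finite_length]). *)

Section Intervals.
Context (T : Type) (le : T -> T -> Prop).

Definition in_interval a b x := le a x /\ le x b.

Definition covers a b :=
  [/\ le a b, a <> b & forall c, le a c -> le c b -> c = a \/ c = b].

Definition maximal_chain a b l (C : nat -> T) :=
  [/\ C 0 = a, C l = b & forall i, (i < l)%N -> covers (C i) (C i.+1)].

Definition unique_chain a b :=
  (exists l C, maximal_chain a b l C) /\
  forall l C l' C', maximal_chain a b l C -> maximal_chain a b l' C' ->
    l = l' /\ forall i, (i <= l)%N -> C i = C' i.

Hypotheses (le_refl : forall a, le a a)
  (le_trans : forall a b c, le a b -> le b c -> le a c).

Lemma maximal_chain_mono a b l C : maximal_chain a b l C ->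
  forall i j, (i <= j <= l)%N -> le (C i) (C j).
Proof.
case=> _ _ cC i j /andP[ij jl]; elim: j ij jl => [|j IH].
  by rewrite leqn0 => /eqP->.
rewrite leq_eqVlt => /predU1P[->//|ij] jl.
apply: (le_trans (IH ij (ltnW jl))).
by case: (cC j jl).
Qed.

Lemma maximal_chain_interval a b l C : maximal_chain a b l C ->
  forall i, (i <= l)%N -> in_interval a b (C i).
Proof.
move=> mC i il; have mono := maximal_chain_mono mC; case: mC => <- <- _.
by split; apply: mono; rewrite ?leqnn ?il.
Qed.
End Intervals.

Definition flip_le T (le : T -> T -> Prop) a b := le b a.

Section IntervalIso.
Context (T T' : Type) (le : T -> T -> Prop) (le' : T' -> T' -> Prop).
Context (a b : T) (a' b' : T') (f : T -> T') (g : T' -> T).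

Definition interval_iso :=
  [/\ f a = a', f b = b',
      forall x, in_interval le a b x -> in_interval le' a' b' (f x) /\ g (f x) = x,
      forall y, in_interval le' a' b' y -> in_interval le a b (g y) /\ f (g y) = y &
      (forall x y, in_interval le a b x -> in_interval le a b y ->
        le x y -> le' (f x) (f y)) /\
      (forall x y, in_interval le' a' b' x -> in_interval le' a' b' y ->
        le' x y -> le (g x) (g y))].
End IntervalIso.

Lemma interval_iso_sym T T' le le' a b a' b' (f : T -> T') (g : T' -> T) :
  (forall c, le c c) -> le a b ->
  interval_iso le le' a b a' b' f g -> interval_iso le' le a' b' a b g f.
Proof.
move=> le_refl ab [fa fb fI gI [fM gM]]; split=> //.
- by rewrite -fa; case: (fI a) => //; split.
- by rewrite -fb; case: (fI b) => //; split.
Qed.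

Section IntervalIsoTransport.
Context (T T' : Type) (le : T -> T -> Prop) (le' : T' -> T' -> Prop).
Hypotheses (le_refl : forall c, le c c)
  (le_trans : forall c d e, le c d -> le d e -> le c e)
  (le'_trans : forall c d e, le' c d -> le' d e -> le' c e).
Context (a b : T) (a' b' : T') (f : T -> T') (g : T' -> T).
Hypothesis fgI : interval_iso le le' a b a' b' f g.

Lemma covers_iso x y : in_interval le a b x -> in_interval le a b y ->
  covers le x y -> covers le' (f x) (f y).
Proof.
case: fgI => fa fb fI gI [fM gM] Ix Iy [lexy neq max].
have [Ifx gfx] := fI x Ix; have [Ify gfy] := fI y Iy.
split; first exact: fM.
  by move=> /(congr1 g); rewrite gfx gfy.
move=> c xc cy.
have Ic : in_interval le' a' b' c.
  split; first by apply: le'_trans xc; case: Ifx.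
  by apply: le'_trans cy _; case: Ify.
have [Igc fgc] := gI c Ic.
have xgc : le x (g c) by rewrite -gfx; apply: gM.
have gcy : le (g c) y by rewrite -gfy; apply: gM.
by case: (max _ xgc gcy) => gcE; [left|right]; rewrite -gcE fgc.
Qed.

Lemma maximal_chain_iso l C :
  maximal_chain le a b l C -> maximal_chain le' a' b' l (f \o C).
Proof.
move=> mC; have IC := maximal_chain_interval le_refl le_trans mC.
case: fgI mC => fa fb _ _ _ [C0 Cl cC]; split=> [||i il] /=.
- by rewrite C0.
- by rewrite Cl.
- by apply: covers_iso (cC i il); apply: IC => //; apply: ltnW.
Qed.
End IntervalIsoTransport.

Section UniqueChainIso.
Context (T T' : Type) (le : T -> T -> Prop) (le' : T' -> T' -> Prop).
Hypotheses (le_refl : forall c, le c c)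
  (le_trans : forall c d e, le c d -> le d e -> le c e)
  (le'_refl : forall c, le' c c)
  (le'_trans : forall c d e, le' c d -> le' d e -> le' c e).

Lemma unique_chain_iso_imply a b a' b' (f : T -> T') (g : T' -> T) :
  le a b -> interval_iso le le' a b a' b' f g ->
  unique_chain le a b -> unique_chain le' a' b'.
Proof.
move=> ab fgI [[l [C mC]] uniqC].
have gfI := interval_iso_sym le_refl ab fgI.
split; first by exists l, (f \o C); exact: (maximal_chain_iso le_refl le_trans le'_trans fgI mC).
move=> l1 C1 l2 C2 m1 m2.
have I1 := maximal_chain_interval le'_refl le'_trans m1.
have I2 := maximal_chain_interval le'_refl le'_trans m2.
have m1' := maximal_chain_iso le'_refl le'_trans le_trans gfI m1.
have m2' := maximal_chain_iso le'_refl le'_trans le_trans gfI m2.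
have [eql eqC] := uniqC _ _ _ _ m1' m2'.
split=> // i il; case: gfI => _ _ gI _ _.
have [_ <-] := gI _ (I1 i il).
have [|_ <-] := gI _ (I2 i _); first by rewrite -eql.
by congr f; apply: eqC.
Qed.
End UniqueChainIso.

Lemma unique_chain_iso T T' (le : T -> T -> Prop) (le' : T' -> T' -> Prop)
    a b a' b' (f : T -> T') (g : T' -> T) :
  (forall c, le c c) -> (forall c d e, le c d -> le d e -> le c e) ->
  (forall c, le' c c) -> (forall c d e, le' c d -> le' d e -> le' c e) ->
  le a b -> le' a' b' ->
  interval_iso le le' a b a' b' f g ->
  unique_chain le a b <-> unique_chain le' a' b'.
Proof.
move=> rT tT rT' tT' ab ab' fgI; split.
  exact: (unique_chain_iso_imply rT tT rT' tT' ab fgI).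
apply: (unique_chain_iso_imply rT' tT' rT tT ab').
exact: interval_iso_sym fgI.
Qed.

Section Flip.
Context (T : Type) (le : T -> T -> Prop).

Lemma covers_flip a b : covers le a b -> covers (flip_le le) b a.
Proof.
case=> ab neq max; split=> // [/esym//|c bc ca].
by case: (max c ca bc); [right|left].
Qed.

Lemma maximal_chain_flip a b l C : maximal_chain le a b l C ->
  maximal_chain (flip_le le) b a l (fun i => C (l - i)%N).
Proof.
case=> C0 Cl cC; split; rewrite ?subn0 ?subnn// => i il.
by rewrite -(subnSK il); apply/covers_flip/cC; rewrite ltn_subrL (leq_ltn_trans _ il).
Qed.

Lemma unique_chain_flip a b :
  unique_chain le a b -> unique_chain (flip_le le) b a.
Proof.
have flipK l C : maximal_chain (flip_le le) b a l C ->
    maximal_chain le a b l (fun i => C (l - i)%N).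
  move=> [C0 Cl cC]; split; rewrite ?subn0 ?subnn// => i il.
  rewrite -(subnSK il).
  have [] := cC (l - i.+1)%N; first by rewrite ltn_subrL (leq_ltn_trans _ il).
  move=> ab neq max; split=> // [/esym//|c bc ca].
  by case: (max c ca bc); [right|left].
move=> [[l [C mC]] uniqC]; split.
  by exists l, (fun i => C (l - i)%N); exact: maximal_chain_flip mC.
move=> l1 C1 l2 C2 /flipK m1 /flipK m2.
have [eql eqC] := uniqC _ _ _ _ m1 m2.
split=> // i il; have := eqC (l1 - i)%N (leq_subr _ _).
by rewrite -eql !subKn.
Qed.
End Flip.

Lemma unique_chain_flipE T (le : T -> T -> Prop) a b :
  unique_chain le a b <-> unique_chain (flip_le le) b a.
Proof. by split; apply: unique_chain_flip. Qed.

(** * Intervals in the lattice of submodules *)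

Section SubmoduleOrder.
Context (A : pzRingType).
Implicit Type V : lmodType A.

(** Function extensionality and proof irrelevance give Leibniz equality, which the poset lemmas are
    phrased with. *)
Lemma submod_eq V (N P : submodClosed V) : N =i P -> N = P.
Proof.
case: N P => N cN [P cP] /= NP.
have {NP}eNP : N = P by apply/funext => x; apply: NP.
case: _ / eNP in cP *; congr GRing.SubmodClosed.Pack.
case: cN cP => [[N1] [N2]] [[P1] [P2]].
by rewrite (Prop_irrelevance N1 P1) (Prop_irrelevance N2 P2).
Qed.

Definition submod_le V (N P : submodClosed V) : Prop := {subset N <= P}.

Lemma submod_le_refl V (N : submodClosed V) : submod_le N N.
Proof. by []. Qed.

Lemma submod_le_trans V (N P Q : submodClosed V) :
  submod_le N P -> submod_le P Q -> submod_le N Q.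
Proof. by move=> NP PQ x /NP/PQ. Qed.

Lemma submod_le_anti V (N P : submodClosed V) :
  submod_le N P -> submod_le P N -> N = P.
Proof. by move=> NP PN; apply: submod_eq => x; apply/idP/idP => [/NP|/PN]. Qed.

Lemma maximal_inP V (K N : submodClosed V) :
  maximal_in K N <-> covers (@submod_le V) K N.
Proof.
split=> -[KN neq max]; split=> //.
- by move=> eq; apply: neq => x; rewrite eq.
- by move=> L KL LN; case: (max L KL LN) => /submod_eq; [left|right].
- by move/submod_eq.
- by move=> L KL LN; case: (max L KL LN) => ->; [left|right].
Qed.

Lemma mem_zero_submod V (x : V) : (x \in zero_submod V) = (x == 0).
Proof. by apply/idP/eqP => [/submod_ofE|->]; rewrite ?rpred0. Qed.

Lemma submodB V (N : submodClosed V) x y : x \in N -> y \in N -> x - y \in N.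
Proof. by move=> Nx Ny; rewrite rpredD // submod_opp. Qed.

Lemma mem_full_submod V (x : V) : x \in full_submod V.
Proof. exact/submod_ofE. Qed.

Lemma zero_submod_le V (N : submodClosed V) : submod_le (zero_submod V) N.
Proof. by move=> x; rewrite mem_zero_submod => /eqP->; rewrite rpred0. Qed.

Lemma submod_le_full V (N : submodClosed V) : submod_le N (full_submod V).
Proof. by move=> x _; exact: mem_full_submod. Qed.

Lemma composition_seriesP V l (C : nat -> submodClosed V) :
  composition_series l C <->
  maximal_chain (@submod_le V) (zero_submod V) (full_submod V) l C.
Proof.
split=> -[C0 Cl cC]; split.
- exact: submod_eq.
- exact: submod_eq.
- by move=> i /cC /maximal_inP.
- by rewrite C0.
- by rewrite Cl.
- by move=> i /cC /maximal_inP.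
Qed.

Lemma uniserialP V : uniserial V <->
  unique_chain (@submod_le V) (zero_submod V) (full_submod V).
Proof.
split=> -[[l [C mC]] uniqC]; split.
- by exists l, C; apply/composition_seriesP.
- move=> l1 C1 l2 C2 /composition_seriesP m1 /composition_seriesP m2.
  have [-> eqC] := uniqC _ _ _ _ m1 m2.
  by split=> // i il; apply/submod_eq/eqC; case: (uniqC _ _ _ _ m1 m2) => ->.
- by exists l, C; apply/composition_seriesP.
- move=> l1 C1 l2 C2 /composition_seriesP m1 /composition_seriesP m2.
  have [? eqC] := uniqC _ _ _ _ m1 m2.
  by split=> // i il; rewrite eqC.
Qed.

Section Submodule.
Context V (N : submodClosed V).

Fact submod_preim_prop (K : submodClosed V) :
  submod_prop (fun y : submod N => val y \in K).
Proof.
split=> [|x y Kx Ky|a x Kx]; first by rewrite raddf0 rpred0.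
  by rewrite raddfD rpredD.
by rewrite linearZ rpredZ.
Qed.

Definition submod_preim K := submod_of (submod_preim_prop K).

Lemma mem_submod_preim K y : (y \in submod_preim K) = (val y \in K).
Proof. by apply/idP/idP => [/submod_ofE|Ky] //; apply/submod_ofE. Qed.

Lemma mem_submod_image (K : submodClosed (submod N)) y :
  (val y \in submod_image K) = (y \in K).
Proof.
apply/idP/idP => [/submod_ofE[z Kz /val_inj->//]|Ky].
by apply/submod_ofE; exists y.
Qed.

Lemma submod_image_le (K : submodClosed (submod N)) : submod_le (submod_image K) N.
Proof. by move=> x /submod_ofE[y _ ->]; exact: valP. Qed.

Lemma submod_imageP (K : submodClosed (submod N)) x :
  x \in submod_image K -> exists2 y, y \in K & x = val y.
Proof. by move/submod_ofE. Qed.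

Lemma submod_interval_iso :
  interval_iso (@submod_le (submod N)) (@submod_le V)
    (zero_submod _) (full_submod _) (zero_submod V) N
    (@submod_image A V N) submod_preim.
Proof.
split.
- apply: submod_le_anti; last exact: zero_submod_le.
  by move=> x /submod_imageP[y]; rewrite mem_zero_submod => /eqP-> ->; rewrite rpred0.
- apply: submod_le_anti; first exact: submod_image_le.
  move=> x Nx; rewrite -[x]/(val (Sub x Nx : submod N)).
  by rewrite mem_submod_image mem_full_submod.
- move=> K _; split.
    by split; [exact: zero_submod_le | exact: submod_image_le].
  by apply: submod_eq => y; rewrite mem_submod_preim mem_submod_image.
- move=> K [_ KN]; split.
    by split; [exact: zero_submod_le | exact: submod_le_full].
  apply: submod_eq => x; apply/idP/idP => [|Kx].
    by move=> /submod_imageP[y]; rewrite mem_submod_preim => Ky ->.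
  rewrite -[x]/(val (Sub x (KN x Kx) : submod N)).
  by rewrite mem_submod_image mem_submod_preim.
- split=> K L _ _ KL x; last by rewrite !mem_submod_preim => /KL.
  by move=> /submod_imageP[y /KL Ly ->]; rewrite mem_submod_image.
Qed.

Lemma uniserial_submod :
  uniserial (submod N) <-> unique_chain (@submod_le V) (zero_submod V) N.
Proof.
apply: (iff_trans (uniserialP _)).
apply: (unique_chain_iso _ _ _ _ _ _ submod_interval_iso);
  by [exact: submod_le_refl | exact: submod_le_trans | exact: zero_submod_le].
Qed.
End Submodule.

Section Quotient.
Context V (N : submodClosed V).

Lemma quot_proj_eq0 x : (quot_proj N x == 0) = (x \in N).
Proof.
rewrite -(raddf0 (quot_proj N)) /quot_proj.
by rewrite piE /quot_equiv subr0.
Qed.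

Lemma quot_proj_repr (z : quotmod N) : quot_proj N (repr z) = z.
Proof. exact: reprK. Qed.

Fact quot_image_prop (K : submodClosed V) :
  submod_prop (fun z : quotmod N => exists2 x, x \in K & z = quot_proj N x).
Proof.
split=> [|z z' [x Kx ->] [x' Kx' ->]|a z [x Kx ->]].
- by exists 0; rewrite ?rpred0 // raddf0.
- by exists (x + x'); rewrite ?rpredD // raddfD.
- by exists (a *: x); rewrite ?rpredZ // linearZ.
Qed.

Definition quot_image K := submod_of (quot_image_prop K).

Lemma mem_quot_preim (K : submodClosed (quotmod N)) x :
  (x \in quot_preim K) = (quot_proj N x \in K).
Proof. by apply/idP/idP => [/submod_ofE|Ky] //; apply/submod_ofE. Qed.

Lemma mem_quot_image K x : submod_le N K ->
  (quot_proj N x \in quot_image K) = (x \in K).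
Proof.
move=> NK; apply/idP/idP => [/submod_ofE[y Ky /eqP]|Kx]; last first.
  by apply/submod_ofE; exists x.
rewrite -subr_eq0 -raddfB quot_proj_eq0 => /NK Kxy.
by rewrite -(subrK y x) rpredD.
Qed.

Lemma quot_preim_ge (K : submodClosed (quotmod N)) : submod_le N (quot_preim K).
Proof.
by move=> x; rewrite mem_quot_preim -quot_proj_eq0 => /eqP->; rewrite rpred0.
Qed.

Lemma quotmod_interval_iso :
  interval_iso (@submod_le (quotmod N)) (@submod_le V)
    (zero_submod _) (full_submod _) N (full_submod V)
    (@quot_preim A V N) quot_image.
Proof.
split.
- by apply: submod_eq => x; rewrite mem_quot_preim mem_zero_submod quot_proj_eq0.
- by apply: submod_eq => x; rewrite mem_quot_preim !mem_full_submod.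
- move=> K _; split.
    by split; [exact: quot_preim_ge | exact: submod_le_full].
  apply: submod_eq => z; rewrite -[z]quot_proj_repr mem_quot_image.
    by rewrite mem_quot_preim.
  exact: quot_preim_ge.
- move=> K [NK _]; split.
    by split; [exact: zero_submod_le | exact: submod_le_full].
  by apply: submod_eq => x; rewrite mem_quot_preim mem_quot_image.
- split=> K L; first by move=> _ _ KL x; rewrite !mem_quot_preim => /KL.
  move=> [NK _] [NL _] KL z.
  by rewrite -[z]quot_proj_repr !mem_quot_image // => /KL.
Qed.

Lemma uniserial_quotmod :
  uniserial (quotmod N) <-> unique_chain (@submod_le V) N (full_submod V).
Proof.
apply: (iff_trans (uniserialP _)).
apply: (unique_chain_iso _ _ _ _ _ _ quotmod_interval_iso);
  by [exact: submod_le_refl | exact: submod_le_trans | exact: submod_le_full].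
Qed.
End Quotient.

(** * Radical and socle layers in terms of covers *)

Lemma simple_submodP V (N : submodClosed V) :
  simple_module (submod N) <-> covers (@submod_le V) (zero_submod V) N.
Proof.
have zN := zero_submod_le N.
split=> [[[x x_neq0] simN]|[_ neq max]].
  split=> // [eq0|K _ KN].
    have : val x \in zero_submod V by rewrite eq0; exact: valP.
    rewrite mem_zero_submod => /eqP vx0.
    by case/eqP: x_neq0; apply: val_inj; rewrite vx0 raddf0.
  case: (simN (submod_preim N K)) => eqK; [left|right]; apply: submod_eq => y.
    apply/idP/idP => [Ky|/zero_submod_le//].
    have := eqK (Sub y (KN y Ky)); rewrite mem_submod_preim Ky mem_zero_submod.
    by move=> /esym/eqP/(congr1 val) /= ->; rewrite rpred0.
  apply/idP/idP => [/KN//|Ny].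
  by have := eqK (Sub y Ny); rewrite mem_submod_preim mem_full_submod.
split.
  apply/not_existsP => noN; apply: neq; apply: submod_le_anti => // x Nx.
  have /negP := noN (Sub x Nx : submod N); rewrite negbK => /eqP /(congr1 val) /= ->.
  exact: rpred0.
move=> K; have := max (submod_image K) (zero_submod_le _) (@submod_image_le _ _ K).
case=> eqK; [left|right] => x; rewrite -mem_submod_image eqK.
  by rewrite !mem_zero_submod; apply/eqP/eqP => [vx0|->]; [apply: val_inj|]; rewrite ?raddf0.
by rewrite mem_full_submod; exact: valP.
Qed.

Lemma simple_quot_covers V (N : submodClosed V) (K : submodClosed (quotmod N)) :
  simple_module (submod K) <-> covers (@submod_le V) N (quot_preim K).
Proof.
have fgI := quotmod_interval_iso N.
have gfI := interval_iso_sym (@submod_le_refl _) (@zero_submod_le _ _) fgI.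
have IK : in_interval (@submod_le _) (zero_submod _) (full_submod _) K.
  by split; [exact: zero_submod_le | exact: submod_le_full].
have I0 : in_interval (@submod_le _) (zero_submod _) (full_submod _) (zero_submod (quotmod N)).
  by split; [exact: zero_submod_le | exact: submod_le_full].
apply: (iff_trans (simple_submodP _)).
have [f0 _ fI _ _] := fgI; have [g0 _ _ _ _] := gfI.
have [IfK gfK] := fI K IK; have [If0 _] := fI _ I0.
split=> cov.
  have := covers_iso (@submod_le_trans _) fgI I0 IK cov.
  by rewrite [quot_preim (zero_submod _)]f0.
rewrite -[zero_submod _]g0 -[K]gfK.
apply: (covers_iso (@submod_le_trans _) gfI) => //.
by split; [exact: submod_le_refl | exact: submod_le_full].
Qed.

Lemma maximal_submod_covers V (N : submodClosed V) (K : submodClosed (submod N)) :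
  maximal_in K (full_submod (submod N)) <-> covers (@submod_le V) (submod_image K) N.
Proof.
have fgI := submod_interval_iso N.
have gfI := interval_iso_sym (@submod_le_refl _) (@zero_submod_le _ _) fgI.
have II L : in_interval (@submod_le _) (zero_submod _) (full_submod _) L.
  by split; [exact: zero_submod_le | exact: submod_le_full].
apply: (iff_trans (maximal_inP _ _)).
have [_ f1 fI _ _] := fgI; have [_ g1 _ _ _] := gfI.
have [IfK gfK] := fI K (II _ K).
split=> cov.
  have := covers_iso (@submod_le_trans _) fgI (II _ K) (II _ (full_submod _)) cov.
  by rewrite [submod_image (full_submod _)]f1.
rewrite -[full_submod _]g1 -[K]gfK.
apply: (covers_iso (@submod_le_trans _) gfI) => //.
by split; [exact: zero_submod_le | exact: submod_le_refl].
Qed.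

(** Simple submodules of the quotient by a socle layer correspond to the covers of that layer. This
    universal property mentions only the order, so it can be transported along an
    anti-isomorphism. *)
Lemma soc_iterS_le V i (N : submodClosed V) :
  submod_le (soc_iter V i.+1) N <->
  submod_le (soc_iter V i) N /\
  forall K, covers (@submod_le V) (soc_iter V i) K -> submod_le K N.
Proof.
rewrite /=; set P := soc_iter V i; split=> [socN|[PN covN] x].
  split=> [|K covK]; first exact/(submod_le_trans _ socN)/quot_preim_ge.
  have PK : submod_le P K by case: covK.
  move=> x Kx; apply: socN; rewrite mem_quot_preim; apply/submod_ofE.
  exists [:: quot_proj P x]; last by rewrite big_seq1.
  move=> y; rewrite inE => /eqP->; exists (quot_image P K); last by rewrite mem_quot_image.
  apply/simple_quot_covers; congr (covers _ _ _): covK.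
  by apply: submod_eq => z; rewrite mem_quot_preim mem_quot_image.
rewrite mem_quot_preim => /submod_ofE[s sims eqx].
(* [x] differs from a sum of representatives of elements of simple submodules by an element of
   [P]. *)
rewrite -(subrK (\sum_(y <- s) repr y) x) rpredD //.
  apply: PN; rewrite -quot_proj_eq0 raddfB raddf_sum /=; apply/eqP.
  rewrite eqx (eq_bigr id) ?subrr // => y _; exact: quot_proj_repr.
rewrite big_seq; apply: rpred_sum => y /sims[K /simple_quot_covers covK Ky].
by apply: (covN _ covK); rewrite mem_quot_preim quot_proj_repr.
Qed.

(** Dual to [soc_iterS_le]. The clause on [rad_iter V i] itself accounts for a layer without maximal
    submodules, which is its own radical. *)
Lemma rad_iterS_ge V i (N : submodClosed V) :
  submod_le N (rad_iter V i.+1) <->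
  submod_le N (rad_iter V i) /\
  forall K, covers (@submod_le V) K (rad_iter V i) -> submod_le N K.
Proof.
rewrite /=; set P := rad_iter V i.
split=> [Nrad|[NP covN] x Nx].
  split=> [|K covK]; first exact/(submod_le_trans Nrad)/submod_image_le.
  move=> x /Nrad/submod_imageP[y /submod_ofE rady ->].
  rewrite -mem_submod_preim; apply: rady; apply/maximal_submod_covers.
  have [KP _ _] := covK.
  have [_ _ _ gI _] := submod_interval_iso P.
  have [|_ ->//] := gI K; first by split=> //; exact: zero_submod_le.
rewrite -[x]/(val (Sub x (NP x Nx) : submod P)) mem_submod_image.
apply/submod_ofE => K /maximal_submod_covers covK.
by rewrite -mem_submod_image /=; apply: covN Nx.
Qed.
End SubmoduleOrder.

(** * Order-reversing bijections of submodule lattices *)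

Section AntiIsomorphism.
Context (A B : pzRingType) (V : lmodType A) (W : lmodType B).
Context (f : submodClosed V -> submodClosed W).
Context (g : submodClosed W -> submodClosed V).
Hypotheses (f_anti : forall N P, submod_le N P -> submod_le (f P) (f N))
  (g_anti : forall N P, submod_le N P -> submod_le (g P) (g N))
  (fK : cancel f g) (gK : cancel g f).

Let le := @submod_le A V.
Let le' := @submod_le B W.

Lemma anti_interval_iso N P :
  interval_iso le (flip_le le') N P (f N) (f P) f g.
Proof.
split=> //.
- by move=> x [Nx xP]; split=> //; split; apply: f_anti.
- move=> y [Ny yP]; split=> //.
  by split; [rewrite -[N]fK | rewrite -[P]fK]; apply: g_anti.
- by split=> x y _ _ xy; [apply: f_anti | apply: g_anti].
Qed.

Let flip_trans c d e : flip_le le' c d -> flip_le le' d e -> flip_le le' c e.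
Proof. by move=> dc ed; apply: submod_le_trans dc. Qed.

Let flip_refl c : flip_le le' c c. Proof. exact: submod_le_refl. Qed.

Lemma anti_unique_chain N P : le N P ->
  unique_chain le N P <-> unique_chain le' (f P) (f N).
Proof.
move=> NP; apply: iff_trans (iff_sym (unique_chain_flipE le' _ _)).
apply: (unique_chain_iso _ _ _ _ _ _ (anti_interval_iso N P)) => //.
- exact: submod_le_refl.
- by move=> c d e; exact: submod_le_trans.
- exact: f_anti.
Qed.

Lemma anti_covers N P : covers le N P -> covers le' (f P) (f N).
Proof.
move=> cov; have NP : le N P by case: cov.
apply: (@covers_flip _ (flip_le le')).
apply: (covers_iso flip_trans (anti_interval_iso N P)) => //; split=> //;
  exact: submod_le_refl.
Qed.

Lemma anti_zero : f (zero_submod V) = full_submod W.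
Proof.
apply: submod_le_anti; first exact: submod_le_full.
by rewrite -[full_submod W]gK; apply: f_anti; exact: zero_submod_le.
Qed.

Lemma anti_full : f (full_submod V) = zero_submod W.
Proof.
apply: submod_le_anti; last exact: zero_submod_le.
by rewrite -[zero_submod W]gK; apply: f_anti; exact: submod_le_full.
Qed.

Lemma anti_has_length l : has_length V l -> has_length W l.
Proof.
move=> [C /composition_seriesP mC]; exists (fun i => f (C (l - i)%N)).
apply/composition_seriesP; case: mC => C0 Cl cC; split=> [||i il].
- by rewrite subn0 Cl anti_full.
- by rewrite subnn C0 anti_zero.
- rewrite -(subnSK il); apply/anti_covers/cC.
  by rewrite ltn_subrL (leq_ltn_trans _ il).
Qed.

(** A module is nonzero exactly when the bottom and the top of its lattice differ. *)
Lemma anti_nonzero : nonzero_module V -> nonzero_module W.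
Proof.
move=> [x x_neq0]; apply/not_existsP => W0.
have zf : zero_submod W = full_submod W.
  apply: submod_le_anti => [|y _]; first exact: zero_submod_le.
  by rewrite mem_zero_submod; apply: contrapT => /negP; exact: W0.
have := mem_full_submod x.
rewrite -[full_submod V]fK anti_full zf -anti_zero fK mem_zero_submod.
by rewrite (negPf x_neq0).
Qed.

End AntiIsomorphism.

Section AntiIsomorphismSerial.
Context (A B : pzRingType) (V : lmodType A) (W : lmodType B).
Context (f : submodClosed V -> submodClosed W).
Context (g : submodClosed W -> submodClosed V).
Hypotheses (f_anti : forall N P, submod_le N P -> submod_le (f P) (f N))
  (g_anti : forall N P, submod_le N P -> submod_le (g P) (g N))
  (fK : cancel f g) (gK : cancel g f).

Lemma anti_rad_iter i : f (rad_iter V i) = soc_iter W i.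
Proof.
elim: i => [|i IH]; first exact: (anti_full f_anti gK).
have galois N P : submod_le (f P) N <-> submod_le (g N) P.
  by split=> [/g_anti|/f_anti]; rewrite ?fK ?gK.
(* Both submodules lie below the same [N], hence are equal: the two universal properties match
   through the Galois connection. *)
have step N : submod_le (soc_iter W i.+1) N <-> submod_le (f (rad_iter V i.+1)) N.
  rewrite soc_iterS_le galois rad_iterS_ge -galois IH.
  split=> -[le_i cov]; split=> // K covK.
    apply/galois/cov; rewrite -IH; exact: (anti_covers f_anti g_anti fK gK).
  rewrite -[K]gK; apply/galois/cov; rewrite -[rad_iter V i]fK IH.
  exact: (anti_covers g_anti f_anti gK fK).
by apply: submod_le_anti; apply/step; exact: submod_le_refl.
Qed.

Lemma anti_uniserial i :
  uniserial (quotmod (rad_iter V i)) <-> uniserial (submod (soc_iter W i)).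
Proof.
apply: (iff_trans (uniserial_quotmod _)).
apply: iff_trans (iff_sym (uniserial_submod _)).
rewrite -anti_rad_iter -(anti_full f_anti gK).
exact: (anti_unique_chain f_anti g_anti fK gK (@submod_le_full _ _ _)).
Qed.

Lemma anti_factor_serial n : n_factor_serial n V <-> n_cofactor_serial n W.
Proof.
have nz : nonzero_module V <-> nonzero_module W.
  by split; [exact: (anti_nonzero f_anti fK gK) | exact: (anti_nonzero g_anti gK fK)].
have len l : has_length V l <-> has_length W l.
  split; first exact: (anti_has_length f_anti g_anti fK gK).
  exact: (anti_has_length g_anti f_anti gK fK).
rewrite /n_factor_serial /n_cofactor_serial nz.
case: eqP => _.
  rewrite !uniserialP -(anti_full f_anti gK) -(anti_zero f_anti gK).
  by rewrite (anti_unique_chain f_anti g_anti fK gK (@submod_le_full _ _ _)).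
by split=> -[nzW [l [/len lenV nl uni nuni]]]; split=> //; exists l; split=> //;
  rewrite ?anti_uniserial // -?anti_uniserial.
Qed.
End AntiIsomorphismSerial.

(** * Finite length *)

Section FiniteLength.
Context (A : pzRingType).
Implicit Type V : lmodType A.

Lemma maximal_avoiding V (N : submodClosed V) x : x \notin N ->
  exists P : submodClosed V, [/\ submod_le N P, x \notin P &
    forall L, submod_le P L -> x \notin L -> L = P].
Proof.
move=> xN.
pose T := {P : submodClosed V | submod_le N P /\ x \notin P}.
pose mkT P (HP : submod_le N P /\ x \notin P) : T := exist _ P HP.
pose leT (P Q : T) : Prop := submod_le (projT1 P) (projT1 Q).
have [|P Q S||C Ctot|[P [NP xP]] maxP] := @Zorn T (fun P Q => `[< leT P Q >]).
- by move=> P; apply/asboolP; exact: submod_le_refl.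
- by move=> /asboolP PQ /asboolP QS; apply/asboolP/(submod_le_trans PQ).
- move=> [P HP] [Q HQ] /asboolP PQ /asboolP QP.
  have PQe : P = Q by exact: submod_le_anti.
  by case: _ / PQe in HQ PQ QP *; rewrite (Prop_irrelevance HP HQ).
(* The union of an empty chain is not a submodule; such a chain is bounded by [N]. *)
- have [[P0 CP0]|C0] := pselect (exists P, C P); last first.
    exists (mkT N (conj (@submod_le_refl _ _ N) xN)) => Q CQ.
    by case: C0; exists Q.
  have unionP : submod_prop (fun y : V => exists2 P : T, C P & y \in projT1 P).
    split.
    - by exists P0 => //; rewrite rpred0.
    - move=> y z [P CP Py] [Q CQ Qz].
      have [/asboolP PQ|/asboolP QP] := Ctot P Q CP CQ.
        by exists Q => //; rewrite rpredD //; apply: PQ.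
      by exists P => //; rewrite rpredD //; apply: QP.
    - by move=> a y [P CP Py]; exists P => //; rewrite rpredZ.
  have NU : submod_le N (submod_of unionP) /\ x \notin submod_of unionP.
    split.
      by case: P0 CP0 => P [NP xP] CP y /NP Py; apply/submod_ofE; exists (exist _ P (conj NP xP)).
    by apply/negP => /submod_ofE[[P [NP xP]] _ /=]; apply/negP.
  exists (mkT _ NU) => Q CQ; apply/asboolP => y Qy.
  by apply/submod_ofE; exists Q.
exists P; split=> // L PL xL.
have NL : submod_le N L by exact: submod_le_trans PL.
have /asboolP PL' : leT (mkT P (conj NP xP)) (mkT L (conj NL xL)) by [].
by have [] := maxP _ PL'.
Qed.

(** A finite chain of covers, built from its lower end: this is the direction of the induction in
    [annihilator_closed]. *)
Inductive finite_length V : submodClosed V -> submodClosed V -> Prop :=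
| finite_length_refl N : finite_length N N
| finite_length_step N P Q :
    covers (@submod_le A V) N P -> finite_length P Q -> finite_length N Q.

Lemma finite_length_trans V (N P Q : submodClosed V) :
  finite_length N P -> finite_length P Q -> finite_length N Q.
Proof.
elim=> // {}N P' {}P cov _ IH /IH; exact: finite_length_step.
Qed.

Lemma finite_length_last V (N P : submodClosed V) : finite_length N P ->
  N = P \/ exists Q, covers (@submod_le A V) Q P.
Proof.
elim=> [|{}N P' Q cov _ [eqP'|]]; first by left.
  by right; exists N; rewrite -eqP'.
by right.
Qed.
End FiniteLength.

(** * Artinian rings and their finitely generated modules have finite length *)

Section ArtinianFiniteLength.
Context (R : comPzRingType).

Lemma artinian_minimal (Q : submodClosed R^o -> Prop) :
  artinian R -> (exists I, Q I) ->
  exists2 I, Q I & forall I', submod_le I' I -> Q I' -> I' = I.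
Proof.
move=> artR [I0 QI0]; apply: contrapT => noMin.
have next (I : {I | Q I}) : exists I' : {I | Q I},
    submod_le (projT1 I') (projT1 I) /\ projT1 I' <> projT1 I.
  case: I => I QI; apply: contrapT => noI'; apply: noMin; exists I => // I' I'I QI'.
  apply: contrapT => neq; apply: noI'; by exists (exist _ I' QI').
have [h hP] := choice next.
pose I k := projT1 (iter k h (exist _ I0 QI0)).
have [k|k Ik] := artR I; first by case: (hP (iter k h (exist _ I0 QI0))).
case: (hP (iter k h (exist _ I0 QI0))) => _; apply.
by apply: submod_eq; exact: (Ik k.+1 (leqnSn k)).
Qed.

Lemma artinian_power (r : R) : artinian R ->
  exists n s, r ^+ n = r ^+ n.+1 * s.
Proof.
move=> artR.
have powP n : submod_prop (fun x : R^o => exists s, x = r ^+ n * s).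
  split=> [|x y [s ->] [t ->]|a x [s ->]].
  - by exists 0; rewrite mulr0.
  - by exists (s + t); rewrite mulrDr.
  - by exists (a * s); rewrite /GRing.scale /= mulrCA.
have [n x|n In] := artR (fun n => submod_of (powP n)).
  by move=> /submod_ofE[s ->]; apply/submod_ofE; exists (r * s); rewrite mulrA -exprSr.
have : r ^+ n \in submod_of (powP n.+1).
  by rewrite (In n.+1 (leqnSn n)); apply/submod_ofE; exists 1; rewrite mulr1.
by move=> /(submod_ofE (powP n.+1))[s rn]; exists n, s.
Qed.

Fact scaling_preim_prop (V : lmodType R) (a b : submodClosed V) (r : R) :
  submod_prop (fun x : V => x \in a /\ r *: x \in b).
Proof.
split=> [|x y [ax bx] [ay b_y]|s x [ax bx]].
- by rewrite scaler0 !rpred0.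
- by split; rewrite ?scalerDr rpredD.
- by split; rewrite ?scalerA 1?mulrC -?scalerA rpredZ.
Qed.

Fact scaling_image_prop (V : lmodType R) (a : submodClosed V) (r : R) :
  submod_prop (fun y : V => exists2 x, x \in a & y = r *: x).
Proof.
split=> [|x y [u au ->] [v av ->]|s x [u au ->]].
- by exists 0; rewrite ?scaler0 ?rpred0.
- by exists (u + v); rewrite ?scalerDr ?rpredD.
- by exists (s *: u); rewrite ?rpredZ // !scalerA mulrC.
Qed.

(** Multiplication by [r] maps [a] onto [r a], so a maximal submodule of [r a] pulls back to one of
    [a]. *)
Lemma scaling_image_covers (V : lmodType R) (a b : submodClosed V) (r : R) :
  covers (@submod_le R V) b (submod_of (scaling_image_prop a r)) ->
  covers (@submod_le R V) (submod_of (scaling_preim_prop a b r)) a.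
Proof.
move=> [b_ra neq max]; split.
- by move=> x /submod_ofE[].
- move=> eqa; apply: neq; apply: submod_le_anti => // y /submod_ofE[x].
  by rewrite -eqa => /submod_ofE[_ bx] ->.
move=> c bc ca.
have bI : submod_le b (submod_of (scaling_image_prop c r)).
  move=> y b_y; have /submod_ofE[x ax yE] := b_ra y b_y.
  by apply/submod_ofE; exists x => //; apply: bc; apply/submod_ofE; rewrite -yE.
have Ia : submod_le (submod_of (scaling_image_prop c r)) (submod_of (scaling_image_prop a r)).
  by move=> y /submod_ofE[x /ca ax ->]; apply/submod_ofE; exists x.
case: (max _ bI Ia) => eqI; [left|right]; apply: submod_le_anti => // x Hx.
  apply/submod_ofE; split; first exact: ca.
  by rewrite -eqI; apply/submod_ofE; exists x.
have : r *: x \in submod_of (scaling_image_prop a r) by apply/submod_ofE; exists x.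
rewrite -eqI => /submod_ofE[y cy rxy].
rewrite -(subrK y x) rpredD //; apply: bc; apply/submod_ofE.
by split; [apply: submodB => //; exact: ca | rewrite scalerBr rxy subrr rpred0].
Qed.

(** Let [a] be minimal among the ideals of infinite length. It has no maximal subideal, yet each
    scalar either kills [a] or acts invertibly on it, so [a] is a nonzero vector space over a field
    and has a hyperplane. *)
Lemma artinian_finite_length :
  artinian R -> finite_length (zero_submod R^o) (full_submod R^o).
Proof.
move=> artR; apply: contrapT => nfl.
have [|a nfla mina] := artinian_minimal
  (Q := fun I => ~ finite_length (zero_submod R^o) I) artR.
  by exists (full_submod R^o).
(* As all proper subideals of [a] have finite length, [a] has no maximal one. *)
have nocov b : ~ covers (@submod_le R R^o) b a.
  move=> cov; have [ba neq _] := cov.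
  apply: nfla; apply: (@finite_length_trans _ _ _ b).
    by apply: contrapT => nflb; apply/neq/mina.
  exact: finite_length_step cov (finite_length_refl _).
(* [r a] is a quotient of [a], so it has no maximal submodule either; being of *)
(* finite length unless it is [a], it is [0] or [a]. *)
have divisible r : (forall x, x \in a -> r *: x = 0) \/
    (forall y, y \in a -> exists2 x, x \in a & y = r *: x).
  have ra_a : submod_le (submod_of (scaling_image_prop a r)) a.
    by move=> y /submod_ofE[x ax ->]; rewrite rpredZ.
  have [eqa|neqa] := pselect (submod_of (scaling_image_prop a r) = a).
    by right=> y; rewrite -{1}eqa => /submod_ofE.
  have : finite_length (zero_submod R^o) (submod_of (scaling_image_prop a r)).
    by apply: contrapT => nfl'; apply/neqa/mina.
  case/finite_length_last => [zr|[b /scaling_image_covers/nocov//]].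
  left=> x ax; apply/eqP; rewrite -mem_zero_submod zr; apply/submod_ofE.
  by exists x.
(* Thus the annihilator of [a] is a maximal ideal and [a] a vector space, in   *)
(* which a subspace maximal without [x0] is a hyperplane: a contradiction. *)
have inverse r x0 : x0 \in a -> r *: x0 != 0 ->
    exists s, forall y, y \in a -> s *: (r *: y) = y.
  move=> ax0 rx0; case: (divisible r) => [/(_ _ ax0) r0|div].
    by rewrite r0 eqxx in rx0.
  have [n [s eqn]] := artinian_power r artR; exists s => y ay.
  (* Dividing [y] by [r] as many times as it takes the powers of [r] to stabilise makes [s] an
     inverse of [r] on [y]. *)
  have [z az ->] : exists2 z, z \in a & y = r ^+ n *: z.
    elim: n {eqn} => [|n [z az ->]]; first by exists y; rewrite // scale1r.
    by have [t at_ ->] := div z az; exists t; rewrite // scalerA -exprSr.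
  by rewrite !scalerA -mulrA -exprS mulrC -eqn.
have [x0 ax0 x0_neq0] : exists2 x0, x0 \in a & x0 != 0.
  apply: contrapT => noa; apply: nfla.
  suff -> : a = zero_submod R^o by exact: finite_length_refl.
  apply: submod_le_anti => [x ax|]; last exact: zero_submod_le.
  by rewrite mem_zero_submod; apply: contrapT => /negP x0; apply: noa; exists x.
have [|P [_ x0P maxP]] := @maximal_avoiding _ _ (zero_submod R^o) x0.
  by rewrite mem_zero_submod.
(* Exchange property: [P + R y] strictly contains [P], so by maximality it contains [x0]. *)
have exch y : y \notin P -> exists r, x0 - r *: y \in P.
  move=> yP.
  have PyP : submod_prop (fun z : R^o => exists r, z - r *: y \in P).
    split=> [|u v [r Pu] [s Pv]|t u [r Pu]].
    - by exists 0; rewrite scale0r subr0 rpred0.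
    - by exists (r + s); rewrite scalerDl opprD addrACA rpredD.
    - by exists (t * r); rewrite -scalerA -scalerBr rpredZ.
  have [/submod_ofE//|/maxP eqP] := boolP (x0 \in submod_of PyP).
  case/negP: yP; rewrite -eqP.
    by apply/submod_ofE; exists 1; rewrite scale1r subrr rpred0.
  by move=> z Pz; apply/submod_ofE; exists 0; rewrite scale0r subr0.
have capP : submod_prop (fun z => z \in a /\ z \in P).
  split=> [|u v [? ?] [? ?]|t u [? ?]]; rewrite ?rpred0 //; split;
    by rewrite ?rpredD ?rpredZ.
apply: (nocov (submod_of capP)); split.
- by move=> x /submod_ofE[].
- by move=> eqa; move: ax0; rewrite -eqa => /submod_ofE[_]; apply/negP.
move=> L capL La; have [LP|] := pselect (forall y, y \in L -> y \in P).
  left; apply: submod_le_anti => // y Ly; apply/submod_ofE.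
  by split; [exact: La | exact: LP].
move=> /existsNP[y /not_implyP[Ly /negP yP]].
have aPL z : z \in a -> z \in P -> z \in L.
  by move=> az Pz; apply: capL; apply/submod_ofE.
have aPL' r z : z \in a -> x0 - r *: z \in P -> x0 - r *: z \in L.
  by move=> az; apply: aPL; rewrite submodB ?rpredZ.
have Lx0 : x0 \in L.
  have [r Pxy] := exch y yP; rewrite -(subrK (r *: y) x0) rpredD ?rpredZ //.
  by apply: aPL' => //; apply: La.
right; apply: submod_le_anti => // z az.
(* Outside [P], exchange puts [r *: z] in [L]; it is nonzero since [x0] is not in [P], so [r] can be
   inverted on [a] to recover [z]. *)
have [Pz|zP] := boolP (z \in P); first exact: aPL.
have [r Pxz] := exch z zP.
have [s sr] : exists s, forall y, y \in a -> s *: (r *: y) = y.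
  apply: (inverse r z az); apply: contraNneq x0P => rz0.
  by rewrite rz0 subr0 in Pxz.
rewrite -(sr z az) rpredZ // -[r *: z](subKr x0) submodB //.
exact: aPL'.
Qed.

Fact ideal_span_prop (V : lmodType R) (N : submodClosed V) (v : V) (I : submodClosed R^o) :
  submod_prop (fun x : V => exists2 r : R, r \in I & x - r *: v \in N).
Proof.
split=> [|x y [r Ir Nx] [s Is Ny]|a x [r Ir Nx]].
- by exists 0; [exact: rpred0 | rewrite scale0r subr0 rpred0].
- by exists (r + s); [exact: rpredD | rewrite scalerDl opprD addrACA rpredD].
- by exists (a * r); [exact: (rpredZ a) | rewrite -scalerA -scalerBr rpredZ].
Qed.

(** This is [N + I v]. *)
Definition ideal_span (V : lmodType R) N v I : submodClosed V :=
  submod_of (@ideal_span_prop V N v I).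

Fact ideal_transporter_prop (V : lmodType R) (L : submodClosed V) (v : V) (I : submodClosed R^o) :
  submod_prop (fun r : R^o => r \in I /\ (r : R) *: v \in L).
Proof.
split=> [|r s [Ir Lr] [Is Ls]|a r [Ir Lr]].
- by split; [exact: rpred0 | rewrite scale0r rpred0].
- by split; [exact: rpredD | rewrite scalerDl rpredD].
- by split; [exact: rpredZ | rewrite -[a *: r]/(a * r) -scalerA rpredZ].
Qed.

(** If [P] covers [I], then [(N + P v) / (N + I v)] is a quotient of the simple module [P / I],
    hence simple or zero. *)
Lemma ideal_span_finite_length (V : lmodType R) (N : submodClosed V) (v : V) I I' :
  finite_length I I' -> finite_length (ideal_span N v I) (ideal_span N v I').
Proof.
elim=> [{}I|{}I P {}I' [IP neq max] _]; first exact: finite_length_refl.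
apply: finite_length_trans.
have spanIP : submod_le (ideal_span N v I) (ideal_span N v P).
  by move=> x /submod_ofE[r /IP Pr Nx]; apply/submod_ofE; exists r.
have [->|neq'] := pselect (ideal_span N v I = ideal_span N v P).
  exact: finite_length_refl.
apply: finite_length_step (finite_length_refl _); split=> // L IL LP.
(* The scalars of [P] that send [v] into [L] form an ideal between [I] and [P], so it is one of
   them, and this decides [L]. *)
pose T := submod_of (ideal_transporter_prop L v P).
have IT : submod_le I T.
  move=> r Ir; apply/submod_ofE; split; first exact: IP.
  by apply: IL; apply/submod_ofE; exists r; rewrite // subrr rpred0.
have NL : submod_le N L.
  by move=> x Nx; apply: IL; apply/submod_ofE; exists 0; [exact: rpred0 | rewrite scale0r subr0].
have TP : submod_le T P by move=> r /submod_ofE[].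
case: (max T IT TP) => eqT; [left|right]; apply: submod_le_anti => // x Hx.
  have /submod_ofE[r Pr Nx] := LP x Hx.
  apply/submod_ofE; exists r => //; rewrite -eqT.
  apply/(submod_ofE (ideal_transporter_prop L v P)); split=> //.
  by rewrite -[_ *: _](subKr x) submodB //; apply: NL.
have /submod_ofE[r Pr Nx] := Hx.
have : r \in T by rewrite eqT.
move=> /(submod_ofE (ideal_transporter_prop L v P))[_ Lr].
rewrite -(subrK (r *: v) x) rpredD //; exact: NL.
Qed.

Lemma fin_gen_finite_length (V : lmodType R) (N : submodClosed V) :
  artinian R -> fin_gen V -> finite_length N (full_submod V).
Proof.
move=> artR [k [v gen]].
(* This is [N] plus the span of the first [m] generators. *)
have spanP m : submod_prop (fun x : V =>
    exists c : 'I_k -> R, x - \sum_(i < k | (i < m)%N) c i *: v i \in N).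
  split=> [|x y [c Nx] [d Ny]|a x [c Nx]].
  - by exists (fun=> 0); rewrite big1 ?subr0 ?rpred0 // => i _; rewrite scale0r.
  - exists (fun i => c i + d i); under eq_bigr do rewrite scalerDl.
    by rewrite big_split opprD addrACA rpredD.
  - exists (fun i => a * c i); under eq_bigr do rewrite -scalerA.
    by rewrite -scaler_sumr -scalerBr rpredZ.
have -> : full_submod V = submod_of (spanP k).
  apply: submod_le_anti; last exact: submod_le_full.
  move=> x _; have [c xE] := gen x; apply/submod_ofE; exists c.
  rewrite (eq_bigl predT) => [|i]; last by rewrite ltn_ord.
  by rewrite -xE subrr rpred0.
suff fl m : (m <= k)%N -> finite_length N (submod_of (spanP m)) by exact: fl.
elim: m => [_|m IH mk].
  suff -> : submod_of (spanP 0%N) = N by exact: finite_length_refl.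
  apply: submod_eq => x; apply/idP/idP => [/submod_ofE[c]|Nx].
    by rewrite big1 ?subr0.
  by apply/submod_ofE; exists (fun=> 0); rewrite big1 ?subr0.
apply: finite_length_trans (IH (ltnW mk)) _.
have := ideal_span_finite_length (submod_of (spanP m)) (v (Ordinal mk))
  (artinian_finite_length artR).
have spanS c : \sum_(i < k | (i < m.+1)%N) c i *: v i =
    c (Ordinal mk) *: v (Ordinal mk) + \sum_(i < k | (i < m)%N) c i *: v i.
  rewrite (bigD1 (Ordinal mk)) //=; congr (_ + _); apply: eq_bigl => i.
  by rewrite -(val_eqE i) /= ltnS andbC -ltn_neqAle.
(* With [v] the next generator, the zero ideal gives the span at [m] and the unit ideal the span at
   [m.+1]. *)
congr finite_length; apply: submod_eq => x; apply/idP/idP.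
- move=> /submod_ofE[r /(submod_ofE (@zero_submod_prop R R^o)) ->].
  by rewrite scale0r subr0.
- by move=> sx; apply/submod_ofE; exists 0; [exact: rpred0 | rewrite scale0r subr0].
- move=> /submod_ofE[r _ /submod_ofE[c Nx]]; apply/submod_ofE.
  exists (fun i => if i == Ordinal mk then r else c i).
  rewrite spanS eqxx opprD addrA.
  rewrite (eq_bigr (fun i => c i *: v i)) // => i im.
  by rewrite -(val_eqE i) /= ltn_eqF.
- move=> /submod_ofE[c]; rewrite spanS opprD addrA => Nx; apply/submod_ofE.
  exists (c (Ordinal mk)); first exact: (@mem_full_submod R R^o).
  by apply/submod_ofE; exists c.
Qed.
End ArtinianFiniteLength.

(** * The minimal injective cogenerator *)

Section CyclicModules.
Context (R : comPzRingType).

Fact cyclic_prop (V : lmodType R) (v : V) :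
  submod_prop (fun x : V => exists r : R, x = r *: v).
Proof.
split=> [|x y [r ->] [s ->]|a x [r ->]].
- by exists 0; rewrite scale0r.
- by exists (r + s); rewrite scalerDl.
- by exists (a * r); rewrite scalerA.
Qed.

Definition cyclic (V : lmodType R) (v : V) : submodClosed V := submod_of (cyclic_prop v).

Lemma simple_cyclic (V : lmodType R) (v : V) : simple_module V -> v != 0 ->
  forall x, exists r : R, x = r *: v.
Proof.
move=> [_ simV] v_neq0 x.
have v_in : v \in cyclic v by apply/submod_ofE; exists 1; rewrite scale1r.
case: (simV (cyclic v)) => eqv.
  by move: v_in; rewrite eqv mem_zero_submod (negPf v_neq0).
by have := mem_full_submod x; rewrite -eqv => /submod_ofE.
Qed.

(** Any nonzero element generates a simple module, so [r *: v] can be sent to [r *: w]; equal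
    annihilators make this well defined and bijective. *)
Lemma simple_isomorphic (V W : lmodType R) (v : V) (w : W) :
  simple_module V -> simple_module W -> v != 0 -> w != 0 ->
  (forall r : R, r *: v = 0 <-> r *: w = 0) -> isomorphic_modules V W.
Proof.
move=> simV simW v_neq0 w_neq0 ann.
have [c cE] := choice (simple_cyclic simV v_neq0).
have [d dE] := choice (simple_cyclic simW w_neq0).
have eqvw r s : r *: v = s *: v <-> r *: w = s *: w.
  by split=> /eqP; rewrite -subr_eq0 -scalerBl => /eqP/ann/eqP;
    rewrite scalerBl subr_eq0 => /eqP.
pose h x := c x *: w.
have h_lin : linear h.
  move=> a x y; rewrite /h scalerA -scalerDl; apply/eqvw.
  by rewrite -cE scalerDl -scalerA -!cE.
pose H := GRing.isLinear.Build R V W _ h h_lin.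
pose hL : {linear V -> W} := HB.pack h H.
exists hL; exists (fun y => d y *: v) => x /=.
  rewrite [RHS]cE; apply/eqvw; rewrite -dE //.
by rewrite /h [RHS]dE; apply/eqvw; rewrite -cE.
Qed.
End CyclicModules.

Section MinimalCogenerator.
Context (R : comPzRingType).

(* For simple [T], the [T]-isotypic part of the socle of [J] is simple or zero. *)
Definition multiplicity_free (J : lmodType R) : Prop := forall j j' : J, j != 0 ->
  (forall r : R, r *: j != 0 -> exists s : R, s *: (r *: j) = j) ->
  (forall r : R, r *: j = 0 -> r *: j' = 0) -> exists t : R, j' = t *: j.

(** Since [R j] is simple and its annihilator kills [e], the nonzero [R e] is simple with the same
    annihilator. By essentiality it meets the image of [f], hence lies in it. *)
Lemma essential_simple (T F J : lmodType R) (f : {linear T -> F}) (j : J) (e : F) :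
  (forall N : submodClosed F, (forall x, f x \in N -> f x = 0) -> N =i zero_submod F) ->
  (forall r : R, r *: j != 0 -> exists s : R, s *: (r *: j) = j) ->
  (forall r : R, r *: j = 0 -> r *: e = 0) -> e != 0 ->
  exists2 u : T, f u = e & forall r : R, r *: e = 0 <-> r *: j = 0.
Proof.
move=> ess simj annj e_neq0.
have sim_e r : r *: e != 0 -> exists2 s : R, s *: (r *: e) = e & s *: (r *: j) = j.
  move=> re; have [|s sr] := simj r.
    by apply: contraNneq re => /annj->.
  exists s => //; apply/eqP; rewrite -subr_eq0 -[X in _ - X]scale1r scalerA -scalerBl.
  by apply/eqP/annj; rewrite scalerBl scale1r -scalerA sr subrr.
have [x [/submod_ofE[r fx] fx_neq0]] : exists x, f x \in cyclic e /\ f x != 0.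
  apply: contrapT => nox; move: e_neq0; rewrite -mem_zero_submod -(ess (cyclic e)).
    by move/negP; apply; apply/submod_ofE; exists 1; rewrite scale1r.
  move=> x fxe; apply: contrapT => /eqP fx_neq0; apply: nox; by exists x.
have [s sr _] : exists2 s : R, s *: (r *: e) = e & s *: (r *: j) = j.
  by apply: sim_e; rewrite -fx.
exists (s *: x); first by rewrite linearZ /= fx.
move=> t; split=> [te|/annj//].
apply: contrapT => /eqP tj; have [u ut] := simj t tj.
have : (1 - u * t) *: e = 0.
  by apply: annj; rewrite scalerBl scale1r -scalerA ut subrr.
by rewrite scalerBl scale1r -scalerA te scaler0 subr0; apply/eqP.
Qed.

Context (r : nat) (S E : 'I_r -> lmodType R).
Hypotheses (S_simples : complete_simples S)
  (E_envelope : forall i, injective_envelope (S i) (E i)).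

(** Each nonzero component of [j] or [j'] lies in the image of some [S i] and has the annihilator of
    [j]. As the [S i] are pairwise non-isomorphic, only one index occurs, and there both components
    come from one simple module. *)
Lemma dirsum_multiplicity_free : multiplicity_free (dirsum E).
Proof.
move=> j j' j_neq0 simj annj.
have [simS isoS _] := S_simples.
have comp (e : dirsum E) i : (forall a : R, a *: j = 0 -> a *: e = 0) -> e i != 0 ->
    forall f : {linear S i -> E i},
    (forall N : submodClosed (E i), (forall x, f x \in N -> f x = 0) -> N =i zero_submod _) ->
    exists2 u, f u = e i & forall a : R, a *: e i = 0 <-> a *: j = 0.
  move=> ann_e ei f ess; apply: (essential_simple ess simj) => // a /ann_e ae.
  by have := congr1 (fun h : dirsum E => h i) ae; rewrite !ffunE.
have same (e e' : dirsum E) i i' :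
    (forall a : R, a *: j = 0 -> a *: e = 0) -> e i != 0 ->
    (forall a : R, a *: j = 0 -> a *: e' = 0) -> e' i' != 0 -> i = i'.
  move=> ann_e ei ann_e' ei'; apply: isoS.
  have [_ [f injf essf]] := E_envelope i; have [_ [f' injf' essf']] := E_envelope i'.
  have [u fu annu] := comp e i ann_e ei f essf.
  have [u' fu' annu'] := comp e' i' ann_e' ei' f' essf'.
  have f0 a : a *: u = 0 <-> a *: e i = 0.
    rewrite -fu -linearZ /=; split=> [->|]; first exact: raddf0.
    by rewrite -(raddf0 f); apply: injf.
  have f'0 a : a *: u' = 0 <-> a *: e' i' = 0.
    rewrite -fu' -linearZ /=; split=> [->|]; first exact: raddf0.
    by rewrite -(raddf0 f'); apply: injf'.
  apply: (@simple_isomorphic _ _ _ u u') => //.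
  - by apply: contraNneq ei => u0; rewrite -fu u0 raddf0.
  - by apply: contraNneq ei' => u0; rewrite -fu' u0 raddf0.
  - by move=> a; rewrite f0 f'0 annu annu'.
have [i0 ji0] : exists i, j i != 0.
  apply: contrapT => noi; case/eqP: j_neq0; apply/ffunP => i; rewrite ffunE.
  by apply: contrapT => /eqP ji; apply: noi; exists i.
have j'0 i : i != i0 -> j' i = 0.
  by move=> neq; apply: contraNeq neq => j'i; apply/eqP/(same j' j).
have j0 i : i != i0 -> j i = 0.
  by move=> neq; apply: contraNeq neq => ji; apply/eqP/(same j j).
have [j'i0|j'i0] := eqVneq (j' i0) 0.
  exists 0; rewrite scale0r; apply/ffunP => i; rewrite ffunE.
  by have [->|/j'0] := eqVneq i i0.
have [_ [f injf essf]] := E_envelope i0.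
have [u fu _] := comp j i0 (fun=> id) ji0 f essf.
have [u' fu' _] := comp j' i0 annj j'i0 f essf.
have u_neq0 : u != 0 by apply: contraNneq ji0 => u0; rewrite -fu u0 raddf0.
have [t u'E] := simple_cyclic (simS i0) u_neq0 u'.
exists t; apply/ffunP => i; rewrite ffunE.
have [->|neq] := eqVneq i i0; first by rewrite -fu -fu' u'E linearZ.
by rewrite j0 // j'0 // scaler0.
Qed.

Definition dirsum_inj i (e : E i) : dirsum E := finfun (dfwith (fun k => 0 : E k) e).

Fact dirsum_inj_linear i : linear (@dirsum_inj i).
Proof.
move=> a x y; apply/ffunP => k; rewrite !ffunE.
by case: dfwithP => [|k' ne]; rewrite ?dfwith_in ?dfwith_out // scaler0 addr0.
Qed.

HB.instance Definition _ i :=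
  GRing.isLinear.Build R (E i) (dirsum E) _ (@dirsum_inj i) (@dirsum_inj_linear i).

(** For [P] maximal above [N] without [x], the module [(P + R x) / P] is simple, so it embeds in
    some [E i]. Injectivity extends the embedding to [X / P], and it does not kill [x]. *)
Lemma dirsum_cogenerator (X : lmodType R) (N : submodClosed X) x : x \notin N ->
  exists2 f : {linear X -> dirsum E}, (forall y, y \in N -> f y = 0) & f x != 0.
Proof.
move=> xN; have [P [NP xP maxP]] := maximal_avoiding xN.
pose Q := ideal_span P x (full_submod R^o).
have PQ : submod_le P Q.
  move=> y Py; apply/submod_ofE; exists 0; first exact: (@mem_full_submod R R^o).
  by rewrite scale0r subr0.
have Qx : x \in Q.
  apply/submod_ofE; exists 1; first exact: (@mem_full_submod R R^o).
  by rewrite scale1r subrr rpred0.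
have covPQ : covers (@submod_le R X) P Q.
  split=> // [eqPQ|L PL LQ]; first by rewrite eqPQ Qx in xP.
  have [xL|/(maxP L PL)] := boolP (x \in L); last by left.
  right; apply: submod_le_anti => // y /submod_ofE[a _ Py].
  by rewrite -(subrK (a *: x) y) rpredD ?rpredZ //; apply: PL.
have simT : simple_module (submod (quot_image P Q)).
  apply/simple_quot_covers; congr (covers _ _ _): covPQ.
  by apply: submod_eq => y; rewrite mem_quot_preim mem_quot_image.
have [_ _ complS] := S_simples; have [i [h bijh]] := complS _ simT.
have [injE [f injf _]] := E_envelope i.
have [g gE] := injE _ _ (\val : {linear submod (quot_image P Q) -> quotmod P})
  (f \o h : {linear _ -> _}) val_inj.
exists (@dirsum_inj i \o (g \o quot_proj P) : {linear X -> dirsum E}).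
  move=> y /NP; rewrite -quot_proj_eq0 /= => /eqP->.
  by rewrite !raddf0.
have Tx : quot_proj P x \in quot_image P Q by rewrite mem_quot_image.
apply/eqP => /(congr1 (fun e : dirsum E => e i)).
rewrite /= !ffunE dfwith_in.
rewrite -[quot_proj P x]/(val (Sub (quot_proj P x) Tx : submod (quot_image P Q))) gE /=.
rewrite -(raddf0 f) => /injf; rewrite -(raddf0 h) => /(bij_inj bijh)/(congr1 val) /= /eqP.
by rewrite quot_proj_eq0 (negPf xP).
Qed.
End MinimalCogenerator.

(** * Annihilators *)

Section Closure.
Context (R : comPzRingType) (X J : lmodType R).
Hypothesis mfJ : multiplicity_free J.

(** Let [N'] cover [N], let [y0] generate [N'] over [N] and let [k0] in [K] not kill [y0]. As [J] is
    multiplicity free, [f] agrees on [N'] with some multiple [t *: k0]; the difference kills [N']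
    and lies in [K] by induction. The closure hypotheses are pointwise, so they also make [K]
    extensional. *)
Lemma annihilator_closed (N : submodClosed X) (K : {linear X -> J} -> Prop) :
  finite_length N (full_submod X) ->
  (forall k : {linear X -> J}, (forall x, k x = 0) -> K k) ->
  (forall (h k l : {linear X -> J}) (r : R), K h -> K k ->
    (forall x, l x = h x + r *: k x) -> K l) ->
  (forall x, x \in N <-> forall k, K k -> k x = 0) ->
  forall f : {linear X -> J}, (forall x, x \in N -> f x = 0) -> K f.
Proof.
have kZ (k : {linear X -> J}) (a : R) x : k (a *: x) = a *: k x by exact: linearZ.
move eqQ: (full_submod X) => Q fl; elim: fl eqQ K => {N Q} [Q <- K K0 _ _ f f0|].
  by apply: K0 => x; apply: f0; exact: mem_full_submod.
move=> N N' Q [NN' neq max] _ IH eqQ K K0 KD KN f f0.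
have [y0 [N'y0 Ny0]] : exists y, y \in N' /\ y \notin N.
  apply: contrapT => noy; apply: neq; apply: submod_le_anti => // y N'y.
  by apply: contrapT => /negP Ny; apply: noy; exists y.
have [k0 [Kk0 k0y0]] : exists k, K k /\ k y0 != 0.
  apply: contrapT => nok; case/negP: Ny0; apply/KN => k Kk.
  by apply: contrapT => /eqP ky0; apply: nok; exists k.
have kN k y : K k -> y \in N -> k y = 0 by move=> Kk /KN; apply.
have gen y : y \in N' -> y \notin N -> forall z, z \in N' -> exists r : R, z - r *: y \in N.
  move=> N'y Ny z N'z; pose L := ideal_span N y (full_submod R^o).
  have NL : submod_le N L.
    move=> x Nx; apply/submod_ofE; exists 0; first exact: (@mem_full_submod R R^o).
    by rewrite scale0r subr0.
  have LN' : submod_le L N'.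
    by move=> x /submod_ofE[r _ /NN' Nxy]; rewrite -(subrK (r *: y) x) rpredD ?rpredZ.
  case: (max L NL LN') => eqL.
    case/negP: Ny; rewrite -eqL; apply/submod_ofE; exists 1.
      exact: (@mem_full_submod R R^o).
    by rewrite scale1r subrr rpred0.
  by move: N'z; rewrite -eqL => /submod_ofE[r _ Nz]; exists r.
(* [k0] embeds the simple module [N' / N] in [J]: [k0 y0] generates a simple submodule, with the
   annihilator of [y0] modulo [N]. *)
have simk0 (r : R) : r *: y0 \notin N ->
    exists2 s : R, y0 - s *: (r *: y0) \in N & s *: (r *: k0 y0) = k0 y0.
  move=> Nr; have [|s Ns] := gen _ _ Nr y0 N'y0; first exact: rpredZ.
  exists s => //; have := kN k0 _ Kk0 Ns.
  by rewrite raddfB /= !kZ => /eqP; rewrite subr_eq0 => /eqP.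
have annk0 (r : R) : r *: k0 y0 = 0 -> r *: y0 \in N.
  move=> rk0; apply: contrapT => /negP/simk0[s _].
  by rewrite rk0 scaler0 => /esym/eqP; rewrite (negPf k0y0).
have mf (j : J) : (forall r : R, r *: k0 y0 = 0 -> r *: j = 0) -> exists t : R, j = t *: k0 y0.
  apply: mfJ => // r rk0; have [|s _ sr] := simk0 r; last by exists s.
  by apply: contra rk0 => Nr; rewrite -kZ /= (kN k0).
have mult (k : {linear X -> J}) : (forall x, x \in N -> k x = 0) ->
    exists t : R, k y0 = t *: k0 y0.
  by move=> kN0; apply: mf => r /annk0/kN0; rewrite kZ.
pose K' (k : {linear X -> J}) := K k /\ forall x, x \in N' -> k x = 0.
have K'sub (k : {linear X -> J}) (t : R) : (forall x, x \in N -> k x = 0) -> k y0 = t *: k0 y0 ->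
    forall x, x \in N' -> k x - t *: k0 x = 0.
  move=> kN0 kt x N'x; have [r Nx] := gen y0 N'y0 Ny0 x N'x.
  rewrite -(subrK (r *: y0) x) (raddfD k) (raddfD k0) /= (kN0 _ Nx) (kN k0 _ Kk0 Nx) !add0r.
  by rewrite !kZ /= kt !scalerA [t * r]mulrC subrr.
(* The step from [N'] to [N]: [K'] has common kernel [N'], because evaluation  *)
(* at any [x] killed by [K'] agrees on [K] with evaluation at a multiple of    *)
(* [y0]. *)
have K'f : forall g : {linear X -> J}, (forall x, x \in N' -> g x = 0) -> K' g.
  apply: (IH eqQ K').
  - by move=> k k0'; split; [exact: K0 | move=> x _].
  - move=> h k l r [Kh h0] [Kk k0'] lE; split; first exact: (KD h k l r).
    by move=> x N'x; rewrite lE h0 // k0' // scaler0 addr0.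
  move=> x; split=> [N'x k [_]|K'x]; first exact.
  have K'k (k l : {linear X -> J}) (t : R) : K k -> k y0 = t *: k0 y0 ->
      (forall z, l z = k z - t *: k0 z) -> K' l.
    move=> Kk kt lE; split.
      by apply: (KD k k0 l (- t)) => // z; rewrite lE scaleNr.
    by move=> z N'z; rewrite lE; apply: K'sub => // w; apply: kN.
  have [s sE] : exists s : R, k0 x = s *: k0 y0.
    (* If [r] kills [k0 y0], then [r \*: k0] kills [N'], so it is in [K'] and kills [x]. It is in
       [K] as [k0 + (r - 1) k0], the form in which closure is given. *)
    apply: mf => r rk0.
    pose l : {linear X -> J} := (r \*: k0)%R.
    have Kl : K l by apply: (KD k0 k0 l (r - 1)) => // z; rewrite scalerBl scale1r addrC subrK.
    apply: (K'x l); apply: (K'k l l 0) => // [|z]; first by rewrite scale0r.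
    by rewrite scale0r subr0.
  rewrite -(subrK (s *: y0) x) rpredD ?rpredZ //; apply: NN'; apply/KN => k Kk.
  have [t kt] := mult k (fun y => kN k y Kk).
  pose l : {linear X -> J} := k \- (t \*: k0).
  have := K'x l (K'k k l t Kk kt (fun=> erefl)) => /= /eqP.
  rewrite subr_eq0 => /eqP kx.
  by rewrite raddfB /= kx kZ /= kt sE !scalerA [t * s]mulrC subrr.
have [t ft] := mult f f0.
pose l : {linear X -> J} := f \- (t \*: k0).
have [Kl _] : K' l by apply: K'f => x; exact: K'sub.
by apply: (KD l k0 f t) => // x; rewrite /= subrK.
Qed.
End Closure.

(** * Annihilators and common kernels between [M] and its dual *)

Section DualLattice.
Context (R : comPzRingType) (Lam : algType R) (M : lmodType Lam) (J : lmodType R).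
Local Notation D := (dual M J).

Fact annihilator_prop (N : submodClosed M) :
  submod_prop (fun f : D => forall x : M, x \in N -> f x = 0).
Proof.
split=> [//|f g f0 g0 x Nx|a f f0 x Nx].
  by rewrite [LHS]/= f0 // g0 // addr0.
by apply: f0; exact: (rpredZ (a : Lam)).
Qed.

Definition annihilator N : submodClosed D := submod_of (annihilator_prop N).

Fact common_kernel_prop (K : submodClosed D) :
  submod_prop (fun x : M => forall f : D, f \in K -> f x = 0).
Proof.
split=> [f _|x y x0 y0 f Kf|a x x0 f Kf]; first exact: raddf0.
  transitivity (f x + f y); first exact: raddfD.
  by rewrite x0 // y0 // addr0.
(* Evaluating [f] at [a *: x] is evaluating [f] acted on by [a] at [x], and [K] is stable under that
   action. *)
by apply: (x0 ((a : Lam^c) *: f)); apply: rpredZ.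
Qed.

Definition common_kernel K : submodClosed M := submod_of (common_kernel_prop K).

Lemma annihilator_anti N P : submod_le N P -> submod_le (annihilator P) (annihilator N).
Proof.
by move=> NP f /submod_ofE f0; apply/submod_ofE => x /NP; apply: f0.
Qed.

Lemma common_kernel_anti K L : submod_le K L -> submod_le (common_kernel L) (common_kernel K).
Proof.
by move=> KL x /submod_ofE x0; apply/submod_ofE => f /KL; apply: x0.
Qed.

Fact restr_submod_prop (N : submodClosed M) :
  submod_prop (fun x : restr M => (x : M) \in N).
Proof.
split=> [|x y|a x Nx]; [exact: rpred0 | exact: rpredD |].
exact: (rpredZ (a%:A : Lam)).
Qed.

Definition restr_submod N : submodClosed (restr M) := submod_of (restr_submod_prop N).

Lemma annihilatorK :
  (forall (N : submodClosed (restr M)) x, x \notin N ->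
    exists2 f : {linear restr M -> J}, (forall y, y \in N -> f y = 0) & f x != 0) ->
  cancel annihilator common_kernel.
Proof.
move=> cogen N; apply: submod_eq => x; apply/idP/idP => [/submod_ofE x0|Nx].
  apply: contrapT => /negP Nx.
  have [|f fN] := cogen (restr_submod N) x.
    by apply/negP => /submod_ofE; apply/negP.
  case/eqP; apply: (x0 f); apply/submod_ofE => y Ny; apply: fN.
  exact/submod_ofE.
by apply/submod_ofE => f /submod_ofE; apply.
Qed.

(** A submodule of the dual is closed under [R]-combinations, through the scalars [r%:A], so
    [annihilator_closed] applies to it over [R]. *)
Lemma common_kernelK : multiplicity_free J ->
  (forall N : submodClosed (restr M), finite_length N (full_submod (restr M))) ->
  cancel common_kernel annihilator.
Proof.
move=> mfJ flM K; apply: submod_eq => f; apply/idP/idP; last first.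
  by move=> Kf; apply/submod_ofE => x /submod_ofE; apply.
move=> /submod_ofE f0.
apply: (@annihilator_closed _ _ _ mfJ (restr_submod (common_kernel K)) (fun k => (k : D) \in K)).
- exact: flM.
- move=> k k0; suff -> : (k : D) = 0 by exact: rpred0.
  exact: dualP.
- move=> h k l r Kh Kk lE.
  suff -> : (l : D) = (h : D) + ((r%:A : Lam) : Lam^c) *: (k : D) by rewrite rpredD // rpredZ.
  by apply: dualP => x; rewrite lE -linearZ.
- by move=> x; split=> [/submod_ofE/submod_ofE|x0]; last exact/submod_ofE/submod_ofE.
- by move=> x /submod_ofE; apply: f0.
Qed.

(** The products of generators of [Lam] over [R] with generators of [M] over [Lam] generate [M] over
    [R]; the pairs of indices are enumerated. *)
Lemma restr_fin_gen : fin_gen (Lam : lmodType R) -> fin_gen M -> fin_gen (restr M).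
Proof.
move=> [p [w genw]] [q [v genv]].
pose T : finType := ('I_q * 'I_p)%type.
exists #|T|, (fun t => (w (enum_val t).2 *: v (enum_val t).1 : M)) => x.
have [a xE] := genv x; have [c aE] := choice (fun i => genw (a i)).
exists (fun t => c (enum_val t).1 (enum_val t).2).
transitivity (\sum_(t : T) (c t.1 t.2 *: w t.2) *: v t.1).
  rewrite xE -(pair_bigA _ (fun i j => (c i j *: w j) *: v i)) /=.
  by apply: eq_bigr => i _; rewrite {1}aE scaler_suml.
rewrite (reindex (@enum_val T predT)) /=; last first.
  by apply: onW_bij; exact: enum_val_bij.
apply: eq_bigr => t _; set c0 := c _ _.
by rewrite -[RHS]/((c0%:A : Lam) *: (w _ *: v _)) scalerA mulr_algl.
Qed.
End DualLattice.

Theorem proposition4p3 (R : comPzRingType) (Lam : algType R)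
    (Lam_artin : artin_algebra Lam)
    (r : nat) (S E : 'I_r -> lmodType R)
    (S_simples : complete_simples S)
    (E_envelope : forall i, injective_envelope (S i) (E i))
    (M : lmodType Lam) (M_fin_gen : fin_gen M)
    (n : nat) (n_gt0 : (0 < n)%N) :
  n_factor_serial n M <-> n_cofactor_serial n (dual M (dirsum E)).
Proof.
have [artR genLam] := Lam_artin.
apply: (@anti_factor_serial _ _ _ _ (@annihilator _ _ M (dirsum E))
  (@common_kernel _ _ M (dirsum E))).
- exact: annihilator_anti.
- exact: common_kernel_anti.
- apply: annihilatorK => N x Nx; exact: (dirsum_cogenerator S_simples E_envelope Nx).
- apply: common_kernelK; first exact: (dirsum_multiplicity_free S_simples E_envelope).
  move=> N; apply: fin_gen_finite_length => //; exact: restr_fin_gen.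
Qed.
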